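(* Suppose that the conductivity tensor is positive definite, i.e. $k_m\xi_i\xi_i\le k_{ij}\xi_i\xi_j\le k_M\xi_i\xi_i$ for all $\xi\in\mathbb{R}^3$, where $k_m(\mathbf{x})>0$ and $k_M(\mathbf{x})$ are the lowest and the greatest eigenvalues of $k_{ij}(\mathbf{x})$, and suppose that $a>0$, $\tau_T>0$ and $\tau_q\ge 0$. Then the initial boundary value problem $\mathcal{P}$ has at most one solution.
   Context: Summation over repeated indices is used, indices range over $\{1,2,3\}$, and a comma followed by $i$ denotes $\partial/\partial x_i$. $B\subset\mathbb{R}^3$ is a regular region (a bounded domain to which the divergence theorem applies) with closure $\overline B$, boundary $\partial B$ and outward unit normal $n_i$. $\Sigma_1,\Sigma_2\subset\partial B$ satisfy $\overline\Sigma_1\cup\Sigma_2=\partial B$ and $\Sigma_1\cap\Sigma_2=\emptyset$. The coefficients $a(\mathbf{x})$, $\varrho(\mathbf{x})$ and the symmetric tensor $k_{ij}(\mathbf{x})$ are given, time-independent, and sufficiently regular on $\overline B$; the constants $\tau_q\ge0$, $\tau_T\ge0$ are the delay times. Problem $\mathcal{P}$: given smooth data $\mathcal{D}=\{r;T^0,q_i^0,\dot q_i^0;\vartheta,\xi\}$, find $\mathcal{S}=\{T,q_i\}$ on $\overline B\times[0,\infty)$ such that on $B\times(0,\infty)$ $$q_i+\tau_q\frac{\partial q_i}{\partial t}+\frac12\tau_q^2\frac{\partial^2 q_i}{\partial t^2}=-k_{ij}T_{,j}-\tau_T k_{ij}\frac{\partial T_{,j}}{\partial t},\qquad -q_{i,i}+\varrho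 r=a\frac{\partial T}{\partial t},$$ with initial conditions $T(\mathbf{x},0)=T^0(\mathbf{x})$, $q_i(\mathbf{x},0)=q_i^0(\mathbf{x})$, $\frac{\partial q_i}{\partial t}(\mathbf{x},0)=\dot q_i^0(\mathbf{x})$ on $\overline B$, and boundary conditions $T=\vartheta$ on $\overline\Sigma_1\times[0,\infty)$, $q_in_i=\xi$ on $\Sigma_2\times[0,\infty)$. A solution is a pair $\{T,q_i\}$ defined on $\overline B\times[0,\infty)$ with $T\in C^{1,1}(B\times(0,\infty))$ and $q_i\in C^{1,2}(B\times(0,\infty))$ (the first superscript refers to space derivatives, the second to time derivatives, the mixed derivatives appearing in the equations being included), satisfying the equations, initial and boundary conditions. Solutions are classical: the fields and the derivatives occurring in the equations and conditions are assumed regular enough up to $\partial B$ and $t=0$ for the conditions to be meaningful and the divergence theorem to be applicable. *)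

(* Defs.v *)
From HB Require Import structures.
From mathcomp Require Import all_boot all_order all_algebra.
From mathcomp Require Import all_classical all_reals all_analysis.

Set Implicit Arguments.
Unset Strict Implicit.
Unset Printing Implicit Defensive.

Import Order.TTheory GRing.Theory Num.Theory.
Import numFieldNormedType.Exports.

Local Open Scope classical_set_scope.
Local Open Scope ring_scope.

(* The norm that the library puts on ['rV[R]_3] is the sup norm; it is only    *)
(* used through the topology and boundedness.  Metric notions (unit vectors,   *)
(* cones, diameters) use the Euclidean norm [enorm].                           *)
Definition dot (R : realType) (u v : 'rV[R]_3) : R :=
  \sum_(i < 3) u 0 i * v 0 i.

Definition enorm (R : realType) (u : 'rV[R]_3) : R := Num.sqrt (dot u u).

Definition partial (R : realType) (i : 'I_3) (f : 'rV[R]_3 -> R)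
    (x : 'rV[R]_3) : R :=
  'D_(delta_mx 0 i) f x.

Definition divergence (R : realType) (F : 'rV[R]_3 -> 'rV[R]_3)
    (x : 'rV[R]_3) : R :=
  \sum_(i < 3) partial i (fun y => F y 0 i) x.

Definition bdry (R : realType) (B : set 'rV[R]_3) : set 'rV[R]_3 :=
  closure B `\` B°.

Definition vec3 (R : realType) (p : R * R * R) : 'rV[R]_3 :=
  \row_(i < 3) [:: p.1.1; p.1.2; p.2]`_i.

Definition volume_integral (R : realType) (B : set 'rV[R]_3)
    (f : 'rV[R]_3 -> R) : \bar R :=
  (\int[(@lebesgue_measure R \x @lebesgue_measure R) \x @lebesgue_measure R]_
     (p in @vec3 R @^-1` B) (f (vec3 p))%:E)%E.

(* 0 is added to the set so that the diameter of the empty set is 0, not -oo.  *)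
Definition diam (R : realType) (U : set 'rV[R]_3) : \bar R :=
  ereal_sup (0%E |` [set (enorm (p.1 - p.2))%:E | p in U `*` U]).

(* Two-dimensional Hausdorff (outer) measure, normalised by pi/4 so that it is *)
(* the area on smooth surfaces.                                                *)
Definition hausdorff2 (R : realType) (A : set 'rV[R]_3) : \bar R :=
  ereal_sup
    [set ereal_inf
       [set (\sum_(0 <= m <oo) ((pi / 4)%:E * (diam (U m) * diam (U m))))%E
       | U in [set U : nat -> set 'rV[R]_3 |
               A `<=` \bigcup_m U m /\ forall m, (diam (U m) <= d%:E)%E]]
    | d in [set d : R | 0 < d]].

(* Near [x] the set [B] contains every narrower cone around [- n] and its      *)
(* closure misses every narrower cone around [n].  Such an [n] is unique, and  *)
(* there is none at edges and corners.                                         *)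
Definition outward_unit_normal (R : realType) (B : set 'rV[R]_3)
    (x n : 'rV[R]_3) : Prop :=
  [/\ bdry B x, enorm n = 1 &
      forall e : R, 0 < e -> exists2 d : R, 0 < d &
        forall y, 0 < enorm (y - x) < d ->
          (dot (y - x) n < - e * enorm (y - x) -> B y) /\
          (e * enorm (y - x) < dot (y - x) n -> ~ closure B y)].

(* The outward unit normal at the points of the boundary that have one, and    *)
(* the zero vector elsewhere.                                                  *)
Definition normal_at (R : realType) (B : set 'rV[R]_3) (x : 'rV[R]_3) :
    'rV[R]_3 :=
  xget 0 [set n | outward_unit_normal B x n].

Notation borel3 R := (g_sigma_algebraType (@open 'rV[R]_3)).

Definition is_surface_measure (R : realType) (B : set 'rV[R]_3)
    (sigma : {measure set (borel3 R) -> \bar R}) : Prop :=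
  forall A : set (borel3 R), measurable A -> sigma A = hausdorff2 (A `&` bdry B).

(* F in C^0(closure B) and C^1(B), with div F continuous up to the boundary.   *)
Definition divergence_admissible (R : realType) (B : set 'rV[R]_3)
    (F : 'rV[R]_3 -> 'rV[R]_3) : Prop :=
  [/\ {within closure B, continuous F},
      forall i j : 'I_3,
        (forall x, B x -> derivable (fun y => F y 0 i) x (delta_mx 0 j)) /\
        {within B, continuous (partial j (fun y => F y 0 i))} &
      exists2 g : 'rV[R]_3 -> R, {within closure B, continuous g} &
        forall x, B x -> g x = divergence F x].

(* [sigma] is determined on Borel sets by [is_surface_measure]: it is area on  *)
(* the boundary.                                                               *)
Definition regular_region (R : realType) (B : set 'rV[R]_3) : Prop :=
  [/\ open B, connected B, B !=set0, bounded_set B &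
      [/\ (hausdorff2 (bdry B) < +oo)%E,
          hausdorff2 (bdry B `&` [set x | ~ exists n, outward_unit_normal B x n])
            = 0%E &
          exists2 sigma : {measure set (borel3 R) -> \bar R},
            is_surface_measure B sigma &
            forall F, divergence_admissible B F ->
              volume_integral B (divergence F) =
              (\int[sigma]_(x in bdry B) (dot (F x) (normal_at B x))%:E)%E]].

Record coefficients (R : realType) := Coefficients {
  heat_capacity : 'rV[R]_3 -> R;
  density : 'rV[R]_3 -> R;
  conductivity : 'rV[R]_3 -> 'M[R]_3;
  tau_q : R;
  tau_T : R }.

Record data (R : realType) := Data {
  supply : 'rV[R]_3 -> R -> R;
  temp0 : 'rV[R]_3 -> R;
  flux0 : 'rV[R]_3 -> 'rV[R]_3;
  flux_rate0 : 'rV[R]_3 -> 'rV[R]_3;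
  temp_bdry : 'rV[R]_3 -> R -> R;
  flux_bdry : 'rV[R]_3 -> R -> R }.

Definition regular_coefficients (R : realType) (B : set 'rV[R]_3)
    (c : coefficients R) : Prop :=
  [/\ {within closure B, continuous (heat_capacity c)},
      {within closure B, continuous (density c)},
      {within closure B, continuous (conductivity c)} &
      forall x, closure B x -> (conductivity c x)^T = conductivity c x].

Definition quad_form (R : realType) (k : 'M[R]_3) (v : 'rV[R]_3) : R :=
  \sum_(i < 3) \sum_(j < 3) k i j * v 0 i * v 0 j.

(* [eigenvalue] refers to row eigenvectors; it is applied to symmetric k.      *)
Definition lowest_eigenvalue (R : realType) (k : 'M[R]_3) (m : R) : Prop :=
  eigenvalue k m /\ forall l, eigenvalue k l -> m <= l.

Definition greatest_eigenvalue (R : realType) (k : 'M[R]_3) (m : R) : Prop :=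
  eigenvalue k m /\ forall l, eigenvalue k l -> l <= m.

Definition positive_definite_on (R : realType) (D : set 'rV[R]_3)
    (k : 'rV[R]_3 -> 'M[R]_3) : Prop :=
  exists km kM : 'rV[R]_3 -> R, forall x, D x ->
    [/\ lowest_eigenvalue (k x) (km x), greatest_eigenvalue (k x) (kM x),
        0 < km x &
        forall v : 'rV[R]_3,
          km x * dot v v <= quad_form (k x) v <= kM x * dot v v].

Definition cont_on (R : realType) (A : set 'rV[R]_3) (I : set R)
    (f : 'rV[R]_3 -> R -> R) : Prop :=
  {within A `*` I, continuous (fun p : 'rV[R]_3 * R => f p.1 p.2)}.

(* A derivative, defined for x in B and t > 0, that extends continuously to    *)
(* closure B x [0,oo).                                                         *)
Definition continuous_up_to_bdry (R : realType) (B : set 'rV[R]_3)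
    (f : 'rV[R]_3 -> R -> R) : Prop :=
  exists2 g : 'rV[R]_3 -> R -> R, cont_on (closure B) `[0, +oo[ g &
    forall x t, B x -> 0 < t -> g x t = f x t.

(* Continuity is the least that smoothness of the data can mean.  The flux     *)
(* data is not required to be continuous in space: it is a value of [q . n],   *)
(* and [n] may jump across the edges of the boundary.                          *)
Definition smooth_data (R : realType) (B S1 S2 : set 'rV[R]_3) (d : data R) :
    Prop :=
  [/\ cont_on (closure B) `[0, +oo[ (supply d),
      [/\ {within closure B, continuous (temp0 d)},
          {within closure B, continuous (flux0 d)} &
          {within closure B, continuous (flux_rate0 d)}],
      cont_on (closure S1) `[0, +oo[ (temp_bdry d) &
      forall x, S2 x -> {within `[0, +oo[, continuous (flux_bdry d x)}].

Definition dt (R : realType) (f : 'rV[R]_3 -> R -> R) : 'rV[R]_3 -> R -> R :=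
  fun x t => derive1 (f x) t.

Definition dx (R : realType) (i : 'I_3) (f : 'rV[R]_3 -> R -> R) :
    'rV[R]_3 -> R -> R :=
  fun x t => partial i (f^~ t) x.

Definition has_dt (R : realType) (B : set 'rV[R]_3)
    (f : 'rV[R]_3 -> R -> R) : Prop :=
  forall x t, B x -> 0 < t -> derivable (f x) t 1.

Definition has_dx (R : realType) (B : set 'rV[R]_3) (i : 'I_3)
    (f : 'rV[R]_3 -> R -> R) : Prop :=
  forall x t, B x -> 0 < t -> derivable (f^~ t) x (delta_mx 0 i).

Definition component (R : realType) (q : 'rV[R]_3 -> R -> 'rV[R]_3) (i : 'I_3) :
    'rV[R]_3 -> R -> R :=
  fun x t => q x t 0 i.

(* C^{1,1}(B x (0,oo)), including the mixed derivative d/dt of T_{,j}.         *)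
Definition C11 (R : realType) (B : set 'rV[R]_3) (T : 'rV[R]_3 -> R -> R) :
    Prop :=
  let C0 := cont_on B `]0, +oo[ in
  [/\ C0 T, has_dt B T, C0 (dt T) &
      forall j, [/\ has_dx B j T, C0 (dx j T),
                    has_dt B (dx j T) & C0 (dt (dx j T))]].

(* C^{1,2}(B x (0,oo)); no mixed derivative of q_i occurs in the equations.    *)
Definition C12 (R : realType) (B : set 'rV[R]_3) (f : 'rV[R]_3 -> R -> R) :
    Prop :=
  let C0 := cont_on B `]0, +oo[ in
  [/\ C0 f, forall j, has_dx B j f /\ C0 (dx j f),
      has_dt B f /\ C0 (dt f) & has_dt B (dt f) /\ C0 (dt (dt f))].

Record is_solution (R : realType) (B S1 S2 : set 'rV[R]_3)
    (c : coefficients R) (d : data R)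
    (T : 'rV[R]_3 -> R -> R) (q : 'rV[R]_3 -> R -> 'rV[R]_3) : Prop := {
  temp_C11 : C11 B T;
  flux_C12 : forall i, C12 B (component q i);
  temp_classical :
    [/\ cont_on (closure B) `[0, +oo[ T, continuous_up_to_bdry B (dt T) &
        forall j, continuous_up_to_bdry B (dx j T) /\
                  continuous_up_to_bdry B (dt (dx j T))];
  flux_classical :
    (forall i, [/\ cont_on (closure B) `[0, +oo[ (component q i),
                   continuous_up_to_bdry B (dt (component q i)) &
                   continuous_up_to_bdry B (dt (dt (component q i)))]) /\
    continuous_up_to_bdry B (fun x t => \sum_(i < 3) dx i (component q i) x t);
  constitutive_eq : forall x t (i : 'I_3), B x -> 0 < t ->
    component q i x t + tau_q c * dt (component q i) x t
      + 2^-1 * tau_q c ^+ 2 * dt (dt (component q i)) x t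
    = - (\sum_(j < 3) conductivity c x i j * dx j T x t)
      - tau_T c * (\sum_(j < 3) conductivity c x i j * dt (dx j T) x t);
  energy_eq : forall x t, B x -> 0 < t ->
    - (\sum_(i < 3) dx i (component q i) x t) + density c x * supply d x t
    = heat_capacity c x * dt T x t;
  temp_init : forall x, closure B x -> T x 0 = temp0 d x;
  flux_init : forall x, closure B x -> q x 0 = flux0 d x;
  flux_rate_init : forall x (i : 'I_3), closure B x ->
    h^-1 * (component q i x h - component q i x 0) @[h --> 0^'+] --> flux_rate0 d x 0 i;
  temp_bc : forall x t, closure S1 x -> 0 <= t -> T x t = temp_bdry d x t;
  (* no condition where the boundary has no normal (edges, corners) *)
  flux_bc : forall x t n, S2 x -> outward_unit_normal B x n -> 0 <= t ->
    dot (q x t) n = flux_bdry d x t }.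

(* Main.v *)
Require Import Defs.
From HB Require Import structures.
From mathcomp Require Import all_boot all_order all_algebra.
From mathcomp Require Import all_classical all_reals all_analysis.
From mathcomp Require Import ring lra.
Import Order.TTheory GRing.Theory Num.Theory.
Import numFieldNormedType.Exports.
Local Open Scope classical_set_scope.
Local Open Scope ring_scope.

(** By linearity it suffices to show that a solution [T], [q] with zero data
vanishes ([is_solution_sub]).  Write [z], [y], [Q] for the primitives in time,
from time 0, of [T], of [g = grad T] and of [q], and [w], [QQ] for those of [y]
and [Q].  All these fields vanish at time 0; for [g] this is [gradient_initial].

Integrating the constitutive equation twice in time gives
[tau_q ^ 2 q / 2 + tau_q Q + QQ = - k (w + tau_T y)]
([constitutive_integrated]), and integrating the energy equation in time gives
[- div Q = a T] and [- div QQ = a z].  Testing the combination of the three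
energy equations with [T] and integrating by parts over [B], where the boundary
conditions annihilate the boundary term, one finds
[(tau_q ^ 2 / 2) <a T, T'> + tau_q <a T, T> + <a z, T> + <k g, w + tau_T y> = 0].
As [T = z'], [g = y'] and [y = w'], this is an evolution equation for
[z], [y] and [w], and no sign of [tau_T - tau_q / 2] is involved.  The term
[<k g, w>] is indefinite, but it equals [<k y, w>' - <k y, y>]; after adding a
multiple of [<k w, w>] the quantity [energy] is nonnegative and grows at most
exponentially ([energy_ge], [energy_rate_le]), so that it stays zero.  It
dominates [a z ^ 2], whence [z = 0] and [T = 0]; the flux then solves an ordinary
differential equation in time ([homogeneous_flux_eq0]).

The integration by parts requires a field that is C^1 in space.  Derivatives of
[q] in space are not controlled as time tends to 0, apart from the divergence, so
[Q] and [QQ] may fail to be differentiable in space.  The divergence theorem is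
therefore applied to [T(t) q(s)] with independent times [t] and [s]
([divergence_pairing]), and the resulting scalar identity is integrated in [s]
([pairing_primitive]).  The only further analysis is differentiation under the
integral over [B] ([is_derive_space_integral]), which rests on the measurability
of open sets in the coordinate space ([open_measurable3]). *)

Set Implicit Arguments.
Unset Strict Implicit.
Unset Printing Implicit Defensive.

(** * Calculus of one variable *)

Section calculus_of_one_variable.
Context {R : realType}.
Implicit Types (f g : R -> R) (t s : R).

Lemma is_derive_mul f g t df dg :
  is_derive t 1 f df -> is_derive t 1 g dg ->
  is_derive t 1 (fun s => f s * g s) (df * g t + f t * dg).
Proof.
move=> hf hg; apply: (is_derive_eq (is_deriveM hf hg)).
by rewrite /GRing.scale /=; ring.
Qed.

Lemma is_derive_add f g t df dg :
  is_derive t 1 f df -> is_derive t 1 g dg ->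
  is_derive t 1 (fun s => f s + g s) (df + dg).
Proof. by move=> hf hg; exact: is_deriveD. Qed.

Lemma is_derive_scale f t (c df : R) :
  is_derive t 1 f df -> is_derive t 1 (fun s => c * f s) (c * df).
Proof. by move=> hf; exact: (@is_deriveZ _ _ _ f c). Qed.

Lemma is_derive_bigsum n (f : 'I_n -> R -> R) t (df : 'I_n -> R) :
  (forall i, is_derive t 1 (f i) (df i)) ->
  is_derive t 1 (fun s => \sum_(i < n) f i s) (\sum_(i < n) df i).
Proof.
move=> hf; have := is_derive_sum hf.
by congr (is_derive _ _ _ _); apply/funext => s; rewrite fct_sumE.
Qed.

(** The function [f s * exp (- M s)] is nonincreasing.  Differentiability is asked
at positive times only, because the equations hold there only. *)
Lemma gronwall f (df : R -> R) (M t : R) :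
  (forall s : R, 0 <= s -> {for s, continuous f}) ->
  (forall s : R, 0 < s -> is_derive s 1 f (df s)) ->
  (forall s : R, 0 < s -> df s <= M * f s) ->
  f 0 = 0 -> 0 <= t -> f t <= 0.
Proof.
move=> cf hf le f0 t0.
pose e s := f s * expR (- M * s).
have he s : 0 < s -> is_derive s 1 e ((df s - M * f s) * expR (- M * s)).
  move=> s0; have hE : is_derive s 1 (fun r => expR (- M * r)) (- M * expR (- M * s)).
    have hl : is_derive s 1 (fun r : R => - M * r) (- M).
      by have := @is_derive_scale id s (- M) 1 (is_derive_id s 1); rewrite mulr1.
    have := @is_derive1_comp _ expR (fun r : R => - M * r) s _ _ (is_derive_expR _) hl.
    by rewrite mulrC.
  by apply: (is_derive_eq (is_derive_mul (hf s s0) hE)); ring.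
have ce : {within `[0, t], continuous e}.
  apply: continuous_in_subspaceT => s; rewrite inE/= in_itv/= => /andP[s0 _].
  apply: cvgM; first exact: cf.
  apply: continuous_comp; last exact: continuous_expR.
  apply: cvgM; [exact: cvg_cst|exact: cvg_id].
have : e t <= e 0.
  have dd s : s \in `]0, t[%R -> derivable e s 1 /\ derive1 e s <= 0.
    rewrite in_itv/= => /andP[s0 _]; have [d1 d2] := he s s0; split => //.
    by rewrite derive1E d2 pmulr_lle0 ?expR_gt0// subr_le0 le.
  apply: (@ler0_derive1_le_cc _ e 0 t) => //.
  - by move=> s /dd[].
  - by move=> s /dd[].
  - by rewrite in_itv/= lexx t0.
  - by rewrite in_itv/= lexx t0.
by rewrite /e f0 mul0r pmulr_lle0 ?expR_gt0.
Qed.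

Lemma derive0_eq0 f t :
  (forall s : R, 0 <= s -> {for s, continuous f}) ->
  (forall s : R, 0 < s -> is_derive s 1 f 0) ->
  f 0 = 0 -> 0 <= t -> f t = 0.
Proof.
move=> cf hf f0 t0; apply/eqP; rewrite eq_le; apply/andP; split.
  by apply: (@gronwall f (fun=> 0) 0 t) => // s; rewrite mul0r.
rewrite -oppr_le0; apply: (@gronwall (fun s => - f s) (fun=> 0) 0 t) => //.
- by move=> s s0; apply: cvgN; exact: cf.
- by move=> s s0; have := is_deriveN (hf s s0); rewrite oppr0.
- by move=> s _; rewrite mul0r.
- by rewrite f0 oppr0.
Qed.

(** Primitives are estimated through their derivative: this bounds a primitive
at [t], of either sign, by a bound of its integrand. *)
Lemma MVT_norm_le f (df : R -> R) (e t : R) :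
  (forall s : R, is_derive s 1 f (df s)) ->
  (forall s : R, `|s| <= `|t| -> `|df s| <= e) -> f 0 = 0 -> `|f t| <= e * `|t|.
Proof.
move=> hf le f0.
have cf (a b : R) : {within `[a, b], continuous f}.
  by apply: derivable_within_continuous => s _; have [] := hf s.
have key c : `|f t| = `|df c * t| -> `|c| <= `|t| -> `|f t| <= e * `|t|.
  by move=> -> ct; rewrite normrM ler_wpM2r// le.
have [t0|t0|t0] := ltgtP t 0; last by rewrite t0 f0 !normr0 mulr0.
- have [c] := MVT t0 (fun s _ => hf s) (cf t 0).
  rewrite in_itv/= f0 sub0r sub0r mulrN => /andP[tc c0] /oppr_inj h.
  by apply: (key c); rewrite ?h// !ltr0_norm// lerN2 ltW.
- have [c] := MVT t0 (fun s _ => hf s) (cf 0 t).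
  rewrite in_itv/= f0 subr0 subr0 => /andP[c0 ct] h.
  by apply: (key c); rewrite ?h// !gtr0_norm// ltW.
Qed.

(** Meant for functions that vanish at negative times: the lower bound 0 may then
be replaced by any negative number, so that [primitive f] is differentiable on
the whole line and 0 is not an end point. *)
Definition primitive f t : R := \int[lebesgue_measure]_(s in `[0, t]) f s.

Lemma primitive_lowerE f (a : R) : a <= 0 -> (forall s : R, s <= 0 -> f s = 0) ->
  primitive f = fun t => \int[lebesgue_measure]_(s in `[a, t]) f s.
Proof.
move=> a0 f0; apply/funext => t; rewrite /primitive.
rewrite Rintegral_mkcond [RHS]Rintegral_mkcond; congr Rintegral.
apply/funext => s; rewrite !patchE !mem_setE !in_itv/=.
have [s0|s0] := ltP s 0; last by rewrite (le_trans a0 s0).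
by rewrite (f0 s (ltW s0)); case: ifP.
Qed.

Lemma is_derive_primitive f t : continuous f -> (forall s : R, s <= 0 -> f s = 0) ->
  is_derive t 1 (primitive f) (f t).
Proof.
move=> cf f0; pose a : R := - `|t| - 1.
have a0 : a <= 0 by rewrite /a; have := normr_ge0 t; lra.
have at_ : a < t by rewrite /a; have := ler_norm (- t); rewrite normrN; lra.
rewrite (primitive_lowerE a0 f0).
have int : (@lebesgue_measure R).-integrable `[a, t + 1] (EFin \o f).
  apply: continuous_compact_integrable; first exact: segment_compact.
  exact: continuous_subspaceT.
have [|h1 h2] := continuous_FTC1_closed _ int at_ (cf t); first by lra.
by apply: DeriveDef => //; rewrite -derive1E.
Qed.

Lemma primitive_causal f t : (forall s : R, s <= 0 -> f s = 0) ->
  t <= 0 -> primitive f t = 0.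
Proof.
move=> f0 t0; rewrite /primitive (@eq_Rintegral _ _ _ _ _ (fun=> 0)).
  by rewrite /Rintegral integral0.
move=> s; rewrite inE/= in_itv/= => /andP[s0 st]; apply: f0.
exact: le_trans st t0.
Qed.

End calculus_of_one_variable.

(** * Fields and their primitives in time *)

Lemma continuous_pair (T U W : topologicalType) (f : T -> U) (g : T -> W) (x : T) :
  {for x, continuous f} -> {for x, continuous g} ->
  {for x, continuous (fun y => (f y, g y))}.
Proof. by move=> cf cg; exact: (cvg_pair cf cg). Qed.

Section regular_fields.
Context {R : realType}.
Notation V := 'rV[R]_3.
Implicit Types (f g : V -> R -> R) (B : set V) (x : V) (t s : R).

(** The working class of fields.  It is stable under sums, products and primitives
in time, and over a bounded open [B] it provides the measurability and the
domination that differentiation under the integral requires.  Continuity is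
joint, and at all real times: solutions are first extended to negative times. *)
Definition regular_field B f : Prop :=
  (forall x t, B x -> {for (x, t), continuous (fun p : V * R => f p.1 p.2)}) /\
  (forall b : R, exists M : R,
     forall x t, B x -> `|t| <= b -> `|f x t| <= M).

(** The inequality is not strict: the value at [t = 0] is where the zero initial
data enter. *)
Definition causal B f : Prop := forall x t, B x -> t <= 0 -> f x t = 0.

Lemma regular_continuous_time B f x :
  regular_field B f -> B x -> continuous (f x).
Proof.
move=> [cf _] Bx t; apply: (@continuous_comp _ _ _ (fun s : R => (x, s))
  (fun p : V * R => f p.1 p.2)); last exact: cf.
by apply: (@continuous_pair _ _ _ (fun=> x) id); [exact: cvg_cst|exact: cvg_id].
Qed.

Lemma regular_continuous_space B f x t :
  regular_field B f -> B x -> {for x, continuous (f^~ t)}.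
Proof.
move=> [cf _] Bx; apply: (@continuous_comp _ _ _ (fun y : V => (y, t))
  (fun p : V * R => f p.1 p.2)); last exact: cf.
by apply: (@continuous_pair _ _ R id (fun=> t)); [exact: cvg_id|exact: cst_continuous].
Qed.

Lemma regular_add B f g : regular_field B f -> regular_field B g ->
  regular_field B (fun x t => f x t + g x t).
Proof.
move=> [cf bf] [cg bg]; split.
  by move=> x t Bx; exact: (cvgD (cf x t Bx) (cg x t Bx)).
move=> b; have [M hM] := bf b; have [N hN] := bg b; exists (M + N) => x t Bx tb.
by apply: (le_trans (ler_normD _ _)); rewrite lerD ?hM ?hN.
Qed.

Lemma regular_mul B f g : regular_field B f -> regular_field B g ->
  regular_field B (fun x t => f x t * g x t).
Proof.
move=> [cf bf] [cg bg]; split.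
  by move=> x t Bx; exact: (cvgM (cf x t Bx) (cg x t Bx)).
move=> b; have [M hM] := bf b; have [N hN] := bg b; exists (M * N) => x t Bx tb.
by rewrite normrM ler_pM ?hM ?hN.
Qed.

Lemma regular_cst B (r : R) : regular_field B (fun _ _ => r).
Proof.
split=> [x t _|b]; first exact: cvg_cst.
by exists `|r|.
Qed.

Lemma regular_scale B (r : R) f : regular_field B f ->
  regular_field B (fun x t => r * f x t).
Proof. by move=> rf; apply: regular_mul => //; exact: regular_cst. Qed.

Lemma regular_sum B n (f : 'I_n -> V -> R -> R) :
  (forall i, regular_field B (f i)) ->
  regular_field B (fun x t => \sum_(i < n) f i x t).
Proof.
move=> rf; elim: n f rf => [|n IH] f rf.
  rewrite (_ : (fun _ _ => _) = fun _ _ => 0); first exact: regular_cst.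
  by apply/funext => x; apply/funext => t; rewrite big_ord0.
rewrite (_ : (fun _ _ => _) = fun x t =>
  f ord0 x t + \sum_(i < n) f (lift ord0 i) x t).
  by apply: regular_add => //; exact: IH.
by apply/funext => x; apply/funext => t; rewrite big_ord_recl.
Qed.

(** Lets the two factors of an energy pairing be taken at different times. *)
Lemma regular_freeze B f t : regular_field B f ->
  regular_field B (fun x _ => f x t).
Proof.
move=> rf; split.
  move=> x s Bx; apply: (@continuous_comp _ _ _ fst (f^~ t)).
    exact: cvg_fst.
  exact: regular_continuous_space rf Bx.
by move=> b; have [M hM] := rf.2 `|t|; exists M => x s Bx _; exact: hM.
Qed.

Definition time_primitive f x t : R := primitive (f x) t.

Lemma is_derive_time_primitive B f x t :
  regular_field B f -> causal B f -> B x ->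
  is_derive t 1 (time_primitive f x) (f x t).
Proof.
move=> rf cf Bx; apply: is_derive_primitive.
  exact: regular_continuous_time rf Bx.
by move=> s; exact: cf.
Qed.

Lemma causal_time_primitive B f : causal B f -> causal B (time_primitive f).
Proof.
by move=> cf x t Bx t0; apply: primitive_causal t0 => s; exact: cf.
Qed.

Lemma time_primitive_dist B f x y t (e : R) :
  regular_field B f -> causal B f -> B x -> B y ->
  (forall s, `|s| <= `|t| -> `|f x s - f y s| <= e) ->
  `|time_primitive f x t - time_primitive f y t| <= e * `|t|.
Proof.
move=> rf cf Bx By h.
apply: (@MVT_norm_le _ (fun s => time_primitive f x s - time_primitive f y s)
  (fun s => f x s - f y s)) => //.
  by move=> s; apply: is_deriveB; exact: (is_derive_time_primitive _ rf).
by rewrite !(causal_time_primitive cf)// subrr.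
Qed.

(** Compactness of the time interval: joint continuity at each point of
[{x} * [- b, b]] is uniform along that segment. *)
Lemma regular_near_uniform B f x (b e : R) :
  open B -> regular_field B f -> B x -> 0 < e ->
  \forall y \near x, forall s, `|s| <= b -> `|f x s - f y s| <= e.
Proof.
move=> oB rf Bx e0.
have := @segment_compact R (- b) b.
move/compact_near_coveringP => /(_ V (nbhs x)
  (fun y s => `|f x s - f y s| <= e) _) => h.
have : \forall y \near x, `[- b, b]%classic `<=`
    (fun s => `|f x s - f y s| <= e).
  apply: h => s _.
  have e2 : 0 < e / 2 by lra.
  have h1 : \forall z \near (s : R, x : V), `|f x s - f z.2 z.1| < e / 2.
    have : {for (s : R, x : V), continuous (fun z : R * V => f z.2 z.1)}.
      apply: (@continuous_comp _ _ _ (fun z : R * V => (z.2, z.1))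
        (fun p : V * R => f p.1 p.2)); last exact: rf.1.
      by apply: (@continuous_pair _ _ _ snd fst); [exact: cvg_snd|exact: cvg_fst].
    by move/cvgrPdist_lt; apply.
  have h2 : \forall z \near (s : R, x : V), `|f x s - f x z.1| < e / 2.
    have : {for (s : R, x : V), continuous (fun z : R * V => f x z.1)}.
      apply: (@continuous_comp _ _ _ fst (f x)); first exact: cvg_fst.
      exact: regular_continuous_time rf Bx _.
    by move/cvgrPdist_lt; apply.
  suff : \forall z \near (s : R, x : V), `|f x z.1 - f z.2 z.1| <= e by [].
  apply: filterS2 h1 h2 => -[s' y]/= a1 a2.
  have -> : f x s' - f y s' = (f x s - f y s') - (f x s - f x s') by ring.
  apply: (le_trans (ler_normB _ _)); lra.
apply: filterS => y hy s sb; apply: hy.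
by rewrite /= in_itv/= -ler_norml.
Qed.

(** The increment of the primitive splits into a change of position at fixed time,
which is small by uniformity in time, and a change of time at fixed position. *)
Lemma regular_time_primitive B f : open B ->
  regular_field B f -> causal B f -> regular_field B (time_primitive f).
Proof.
move=> oB rf cf; split; last first.
  move=> b; have [M hM] := rf.2 b; exists (Num.max M 0 * Num.max b 0).
  move=> x t Bx tb.
  apply: (@le_trans _ _ (Num.max M 0 * `|t|)); last first.
    by rewrite ler_wpM2l// le_max ?lexx ?orbT ?tb.
  apply: (@MVT_norm_le _ (time_primitive f x) (f x)).
  - by move=> s; exact: (is_derive_time_primitive _ rf).
  - by move=> s st; rewrite le_max hM// (le_trans st).
  - exact: (causal_time_primitive cf).
move=> x t Bx; apply/cvgrPdist_lt => /= e e0.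
pose b := `|t| + 1.
have b0 : 0 < b by rewrite /b; have := normr_ge0 t; lra.
have d0 : 0 < e / (4 * b) by rewrite divr_gt0//; lra.
have h1 : \forall p \near (x, t), forall s, `|s| <= b ->
    `|f x s - f p.1 s| <= e / (4 * b).
  exact: (@cvg_fst _ _ (nbhs x) (nbhs t) _ _ (regular_near_uniform b oB rf Bx d0)).
have h2 : \forall p \near (x, t), B p.1.
  exact: (@cvg_fst _ _ (nbhs x) (nbhs t) _ _ (open_nbhs_nbhs (conj oB Bx))).
have h3 : \forall p \near (x, t), `|t - p.2| < 1.
  apply: (@cvg_snd _ _ (nbhs x) (nbhs t) _ [set s | `|t - s| < 1]).
  have : (id : R -> R) s @[s --> t] --> t by exact: cvg_id.
  by move/cvgrPdist_lt; apply.
have h4' : \forall s \near t,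
    `|time_primitive f x t - time_primitive f x s| < e / 2.
  have ct : {for t, continuous (time_primitive f x)}.
    apply: differentiable_continuous; apply/derivable1_diffP.
    by have [] := is_derive_time_primitive t rf cf Bx.
  by move/cvgrPdist_lt: ct; apply; lra.
have h4 : \forall p \near (x, t),
    `|time_primitive f x t - time_primitive f x p.2| < e / 2.
  exact: (@cvg_snd _ _ (nbhs x) (nbhs t) _ _ h4').
suff : \forall p \near (x, t),
    `|time_primitive f x t - time_primitive f p.1 p.2| < e by [].
apply: filterS3 (filterI h1 h2) h3 h4 => -[y s]/= [a1 a2] a3 a4.
have sb : `|s| <= b.
  rewrite /b -[s](subKr t); apply: (le_trans (ler_normB _ _)); lra.
have a5 : `|time_primitive f x s - time_primitive f y s| <= e / (4 * b) * `|s|.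
  by apply: (time_primitive_dist rf cf Bx a2) => r rs; apply: a1; exact: le_trans sb.
have a6 : e / (4 * b) * `|s| <= e / 4.
  have -> : e / 4 = e / (4 * b) * b by field; lra.
  by rewrite ler_wpM2l// ltW.
have -> : time_primitive f x t - time_primitive f y s =
  (time_primitive f x t - time_primitive f x s) +
  (time_primitive f x s - time_primitive f y s) by ring.
apply: (le_lt_trans (ler_normD _ _)); lra.
Qed.

End regular_fields.

(** * Volume on the coordinate space *)

Section measurable_boxes.
Context {R : realType}.
Notation V := 'rV[R]_3.
Notation coord := (measurableTypeR R * measurableTypeR R * measurableTypeR R)%type.

(** Open boxes with rational corners, a countable base of the topology of
[R * R * R] that consists of measurable sets of nonzero volume. *)
Definition rational_box (q : (rat * rat) * (rat * rat) * (rat * rat)) :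
    set (R * R * R) :=
  [set p | [/\ ratr q.1.1.1 < p.1.1 < ratr q.1.1.2,
               ratr q.1.2.1 < p.1.2 < ratr q.1.2.2 &
               ratr q.2.1 < p.2 < ratr q.2.2]].

Lemma measurable_box (A1 A2 A3 : set (measurableTypeR R)) :
  measurable A1 -> measurable A2 -> measurable A3 ->
  measurable (A1 `*` A2 `*` A3 : set coord).
Proof. by move=> m1 m2 m3; apply: measurableX => //; exact: measurableX. Qed.

Lemma rational_boxE q : rational_box q =
  `]ratr q.1.1.1, ratr q.1.1.2[%classic `*`
  `]ratr q.1.2.1, ratr q.1.2.2[%classic `*`
  `]ratr q.2.1, ratr q.2.2[%classic.
Proof.
apply/seteqP; split=> [p [h1 h2 h3]|p [[h1 h2] h3]].
  by split; [split|]; rewrite /= in_itv.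
by move: h1 h2 h3; rewrite /= !in_itv /=; split.
Qed.

Lemma measurable_rational_box q : measurable (rational_box q : set coord).
Proof. by rewrite rational_boxE; exact: measurable_box. Qed.

Lemma open_contains_rational_box (U : set (R * R * R)) p : open U -> U p ->
  exists2 q, rational_box q p & rational_box q `<=` U.
Proof.
move=> oU Up; have : nbhs p U by exact: open_nbhs_nbhs.
rewrite -nbhs_ballE => -[/= e e0 peU].
have lo (r : R) : exists a b : rat, ratr a < r < ratr b /\
    (forall s : R, ratr a < s < ratr b -> `|r - s| < e).
  have h1 : r - e < r by rewrite ltrBlDr ltrDl.
  have h2 : r < r + e by rewrite ltrDl.
  have [a] := rat_in_itvoo h1; rewrite in_itv/= => /andP[a1 a2].
  have [b] := rat_in_itvoo h2; rewrite in_itv/= => /andP[b1 b2].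
  exists a, b; rewrite a2 b1; split => // s /andP[s1 s2].
  by rewrite ltr_norml; apply/andP; split; lra.
have [a1 [b1 [p1 h1]]] := lo p.1.1.
have [a2 [b2 [p2 h2]]] := lo p.1.2.
have [a3 [b3 [p3 h3]]] := lo p.2.
exists ((a1, b1), (a2, b2), (a3, b3)); first by split.
move=> s [s1 s2 s3]; apply: peU.
by split; [split|]; [exact: h1|exact: h2|exact: h3].
Qed.

(** An open set is the union of the rational boxes it contains, and there are
countably many of them. *)
Lemma open_measurable3 (U : set (R * R * R)) :
  open U -> measurable (U : set coord).
Proof.
move=> oU; pose F q := if pselect (rational_box q `<=` U) then rational_box q
  else set0.
rewrite (_ : U = \bigcup_q F q); last first.
  apply/seteqP; split => [p Up|p [q _]]; last first.
    by rewrite /F; case: pselect => // qU /qU.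
  have [q qp qU] := open_contains_rational_box oU Up.
  by exists q => //; rewrite /F; case: pselect => [bU|nbU].
apply: countable_bigcupT_measurable => [|q]; first exact: countableP.
rewrite /F; case: pselect => [bU|nbU] /=.
  exact: measurable_rational_box.
exact: measurable0.
Qed.

Lemma vec3_continuous : continuous (@vec3 R).
Proof.
move=> p; apply/cvg_ballP => e e0.
apply: (@filterS _ (nbhs p) _ (ball p e)); last exact: nbhsx_ballx.
move=> s [[b1 b2] b3]; split => // i j; rewrite /vec3 !mxE.
by case: j => -[|[|[|//]]] /=.
Qed.

Definition coordinates (x : V) : R * R * R := (x 0 0, x 0 1, x 0 (inord 2)).

Lemma coordinatesK x : vec3 (coordinates x) = x.
Proof.
apply/rowP => -[[|[|[|//]]] i]; rewrite mxE /=; congr (x _ _); apply/val_inj => //=.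
by rewrite inordK.
Qed.

Lemma measurable_region (B : set V) : open B ->
  measurable (@vec3 R @^-1` B : set coord).
Proof.
move=> oB; apply: open_measurable3; apply: open_comp oB => p _.
exact: vec3_continuous.
Qed.

Lemma measurable_continuous_on (B : set V) (f : V -> R) : open B ->
  (forall x, B x -> {for x, continuous f}) ->
  measurable_fun (@vec3 R @^-1` B : set coord) (fun p : coord => f (vec3 p)).
Proof.
move=> oB cf; apply: (measurability _ (measurable_realfun.RGenOpens.measurableE R)).
move=> _ [_ [a [b ->] <-]]; apply: open_measurable3.
rewrite openE => p [/= Bp fp].
have h1 : nbhs p (@vec3 R @^-1` B).
  by apply: vec3_continuous; exact: open_nbhs_nbhs.
have h2 : nbhs p (fun s => `]a, b[%classic (f (vec3 s))).
  have : {for p, continuous (f \o @vec3 R)}.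
    by apply: continuous_comp; [exact: vec3_continuous|exact: cf].
  by apply; apply: open_nbhs_nbhs; split => //; exact: interval_open.
by apply: filterS2 h1 h2 => s; split.
Qed.

Definition volume : {measure set coord -> \bar R} :=
  ((@lebesgue_measure R \x @lebesgue_measure R) \x @lebesgue_measure R)%E.

Lemma volume_box (A1 A2 A3 : set (measurableTypeR R)) :
  measurable A1 -> measurable A2 -> measurable A3 ->
  volume (A1 `*` A2 `*` A3) =
  (lebesgue_measure A1 * lebesgue_measure A2 * lebesgue_measure A3)%E.
Proof.
move=> m1 m2 m3; rewrite /volume /= product_measure1E//; last exact: measurableX.
by rewrite /= product_measure1E.
Qed.

Lemma volume_region_lty (B : set V) : open B -> bounded_set B ->
  (volume (@vec3 R @^-1` B) < +oo)%E.
Proof.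
move=> oB [M [_ hM]]; pose b := Num.max 0 M + 1.
have b0 : 0 < b by rewrite /b ltr_wpDl// le_max lexx.
have Mb : M < b by rewrite /b ltr_pwDr// le_max lexx orbT.
pose I : set (measurableTypeR R) := `[- b, b]%classic.
have mI : measurable I by exact: measurable_itv.
have sub : @vec3 R @^-1` B `<=` I `*` I `*` I.
  move=> p /= Bp; have hb := hM b Mb _ Bp.
  have co i : `|vec3 p 0 i| <= b.
    apply: le_trans hb; rewrite [leRHS]mx_normrE.
    exact: (le_bigmax _ (fun ij : 'I_1 * 'I_3 => `|vec3 p ij.1 ij.2|) (0, i)).
  have := (co 0, co 1, co (inord 2)); rewrite /vec3 !mxE inordK//= => -[[]].
  by rewrite /I /= !in_itv/= -!ler_norml; split.
apply: (@le_lt_trans _ _ (volume (I `*` I `*` I))).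
  apply: le_measure; rewrite ?inE//; first exact: measurable_region.
  exact: measurable_box.
rewrite volume_box// lebesgue_measure_itv/=.
by case: ifP => _; rewrite -?EFinB -?EFinM ?mule0 ltry.
Qed.

Lemma volume_rational_box_gt0 q p : rational_box q p -> (0 < volume (rational_box q))%E.
Proof.
move=> [/andP[a1 a2] /andP[b1 b2] /andP[c1 c2]].
rewrite rational_boxE.
have -> : volume (`]ratr q.1.1.1, ratr q.1.1.2[%classic `*`
  `]ratr q.1.2.1, ratr q.1.2.2[%classic `*`
  `]ratr q.2.1, ratr q.2.2[%classic) =
   (lebesgue_measure (`]ratr q.1.1.1, ratr q.1.1.2[%classic : set R) *
    lebesgue_measure (`]ratr q.1.2.1, ratr q.1.2.2[%classic : set R) *
    lebesgue_measure (`]ratr q.2.1, ratr q.2.2[%classic : set R))%E by exact: volume_box.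
rewrite !lebesgue_measure_itv/= !lte_fin.
by rewrite (lt_trans a1 a2) (lt_trans b1 b2) (lt_trans c1 c2) -!EFinB -!EFinM
  lte_fin !mulr_gt0// subr_gt0 ?(lt_trans a1 a2) ?(lt_trans b1 b2) ?(lt_trans c1 c2).
Qed.

End measurable_boxes.

(** * Integrals over a region *)

Section integrals_over_a_region.
Context {R : realType}.
Notation V := 'rV[R]_3.
Variable B : set V.
Hypotheses (oB : open B) (bB : bounded_set B).
Implicit Types (f g : V -> R -> R) (t s : R).

Definition space_integral f t : R :=
  \int[volume]_(p in @vec3 R @^-1` B) f (vec3 p) t.

Let mD := measurable_region oB.

Lemma regular_integrable f t : regular_field B f ->
  volume.-integrable (@vec3 R @^-1` B) (EFin \o (fun p => f (vec3 p) t)).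
Proof.
move=> rf; apply: measurable_bounded_integrable => //.
- exact: volume_region_lty.
- apply: (measurable_continuous_on (f := f^~ t)) => // x Bx.
  exact: regular_continuous_space rf Bx.
- have [M hM] := rf.2 `|t|; exists M; split; first exact: num_real.
  by move=> r Mr p /= Bp; apply: le_trans (ltW Mr); exact: hM.
Qed.

Lemma space_integral_add f g t : regular_field B f -> regular_field B g ->
  space_integral (fun x s => f x s + g x s) t =
  space_integral f t + space_integral g t.
Proof. by move=> rf rg; apply: RintegralD => //; exact: regular_integrable. Qed.

Lemma space_integral_scale f r t : regular_field B f ->
  space_integral (fun x s => r * f x s) t = r * space_integral f t.
Proof. by move=> rf; apply: RintegralZl => //; exact: regular_integrable. Qed.

Lemma space_integral_le f g t : regular_field B f -> regular_field B g ->
  (forall x, B x -> f x t <= g x t) -> space_integral f t <= space_integral g t.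
Proof.
move=> rf rg fg; apply: le_Rintegral => //; try exact: regular_integrable.
by move=> p; exact: fg.
Qed.

Lemma eq_space_integral f g t s : (forall x, B x -> f x t = g x s) ->
  space_integral f t = space_integral g s.
Proof. by move=> fg; apply: eq_Rintegral => p; rewrite inE => /fg. Qed.

Lemma space_integral0 f t : (forall x, B x -> f x t = 0) ->
  space_integral f t = 0.
Proof.
move=> f0; rewrite (@eq_space_integral _ (fun _ _ => 0) t t)//.
by rewrite /space_integral /Rintegral integral0.
Qed.

Lemma space_integral_continuous f : regular_field B f ->
  continuous (space_integral f).
Proof.
move=> rf t; have [M hM] := rf.2 (`|t| + 1).
have tI : t \in (`]t - 1, t + 1[%classic : set R).
  by rewrite inE/= in_itv/= ltrBlDr ltrDl ltr01.
have It s : (`]t - 1, t + 1[%classic : set R) s -> `|s| <= `|t| + 1.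
  rewrite /= in_itv/= => /andP[s1 s2]; rewrite -[s](subKr t).
  apply: (le_trans (ler_normB _ _)); rewrite lerD2l ler_norml.
  by apply/andP; split; lra.
apply: (@continuity_under_integral _ _ _ volume (fun s p => f (vec3 p) s)
  _ mD (t - 1) (t + 1) _ _ (fun=> M) _ _ t tI).
- by move=> s _; exact: regular_integrable.
- apply: aeW => p Bp s _; exact: regular_continuous_time rf Bp _.
- exact: (regular_integrable (f := fun _ _ => M) 0 (regular_cst _ _)).
- by move=> s /It sI; apply: aeW => p Bp; exact: hM.
Qed.

(** The boundedness of [df] on bounded time intervals is the domination. *)
Lemma is_derive_space_integral f df t :
  regular_field B f -> regular_field B df -> 0 < t ->
  (forall x s, B x -> 0 < s -> is_derive s 1 (f x) (df x s)) ->
  is_derive t 1 (space_integral f) (space_integral df t).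
Proof.
move=> rf rdf t0 hf; have [M hM] := rdf.2 (t + 1).
pose G : R * R * R -> R := fun=> Num.max M 0.
have tI : (`]0, t + 1[%classic : set R) t by rewrite /= in_itv/= t0 ltrDl ltr01.
have E p s : (@vec3 R @^-1` B) p -> 0 < s ->
    partial1of2 (fun s p => f (vec3 p) s) s p = df (vec3 p) s.
  by move=> Bp s0; rewrite partial1of2E; have [_] := hf _ _ Bp s0.
have G0 y : 0 <= G y by rewrite /G le_max lexx orbT.
have iG : volume.-integrable (@vec3 R @^-1` B) (EFin \o G).
  exact: (regular_integrable (f := fun _ _ => Num.max M 0) 0 (regular_cst _ _)).
have If s : (`]0, t + 1[%classic : set R) s ->
    volume.-integrable (@vec3 R @^-1` B) (EFin \o (fun p => f (vec3 p) s)).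
  by move=> _; exact: regular_integrable.
have Df s p : (`]0, t + 1[%classic : set R) s -> (@vec3 R @^-1` B) p ->
    derivable (f (vec3 p)) s 1.
  by rewrite /= in_itv/= => /andP[s0 _] Bp; have [] := hf _ _ Bp s0.
have Gub s p : (`]0, t + 1[%classic : set R) s -> (@vec3 R @^-1` B) p ->
    `|partial1of2 (fun s p => f (vec3 p) s) s p| <= G p.
  rewrite /= in_itv/= => /andP[s0 st] Bp; rewrite E//.
  by rewrite /G le_max hM// gtr0_norm// ltW.
have h1 := @derivable_under_integral _ _ _ volume (fun s p => f (vec3 p) s) _ mD
  t 0 (t + 1) tI If Df G G0 iG Gub.
have h2 := @differentiation_under_integral _ _ _ volume (fun s p => f (vec3 p) s) _ mD
  t 0 (t + 1) tI If Df G G0 iG Gub.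
apply: DeriveDef; first exact: h1.
rewrite -derive1E h2; apply: eq_Rintegral => p; rewrite inE => Bp; exact: E.
Qed.

(** If the integrand were positive at [x] it would exceed half its value on a box
around [x], and the box has positive volume. *)
Lemma space_integral_eq0 f t x : regular_field B f ->
  (forall y, B y -> 0 <= f y t) -> space_integral f t <= 0 -> B x -> f x t = 0.
Proof.
move=> rf f0 int0 Bx; apply/eqP; rewrite eq_le f0// andbT leNgt.
apply/negP => fx.
pose U : set (R * R * R) := [set p | B (vec3 p) /\ f x t / 2 < f (vec3 p) t].
have oU : open U.
  rewrite openE => p [/= Bp fp].
  have h1 : nbhs p (@vec3 R @^-1` B).
    by apply: vec3_continuous; exact: open_nbhs_nbhs.
  have h2 : nbhs p (fun z => `]f x t / 2, +oo[%classic (f (vec3 z) t)).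
    have : {for p, continuous ((f^~ t) \o @vec3 R)}.
      apply: continuous_comp; first exact: vec3_continuous.
      exact: regular_continuous_space rf Bp.
    apply; apply: open_nbhs_nbhs; split; first exact: interval_open.
    by rewrite /= in_itv/= andbT.
  by apply: filterS2 h1 h2 => z; rewrite /= in_itv/= andbT; split.
have Ux : U (coordinates x) by rewrite /U /= coordinatesK; split => //; lra.
have [q qx qU] := open_contains_rational_box oU Ux.
have mq := @measurable_rational_box R q.
have qD : rational_box q `<=` @vec3 R @^-1` B by move=> p /qU[].
have vq := volume_rational_box_gt0 qx.
have /integrableP[mf _] := regular_integrable t rf.
have h : ((f x t / 2)%:E * volume (rational_box q) <=
    \int[volume]_(p in @vec3 R @^-1` B) (f (vec3 p) t)%:E)%E.
  rewrite -integral_cst//.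
  apply: (@le_trans _ _ (\int[volume]_(p in rational_box q) (f (vec3 p) t)%:E)%E).
    apply: ge0_le_integral => //.
    - by move=> p _; rewrite lee_fin; lra.
    - exact: measurable_funS mf.
    - by move=> p /qU[_ /ltW]; rewrite lee_fin.
  by apply: ge0_subset_integral => // p Bp; rewrite lee_fin f0.
move: int0; rewrite leNgt => /negP; apply.
rewrite -lte_fin [X in (_ < X)%E]fineK; last first.
  by apply: integrable_fin_num => //; exact: regular_integrable.
by apply: lt_le_trans h; rewrite mule_gt0// lte_fin; lra.
Qed.

End integrals_over_a_region.

(** * The energy estimate *)

Section conduction_form.
Context {R : realType}.
Implicit Types (k : 'M[R]_3) (u v : 'I_3 -> R).

(** Grouped so that the inner sum is the one in the constitutive equation. *)
Definition conduction_form k u v : R :=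
  \sum_(i < 3) (\sum_(j < 3) k i j * v j) * u i.

Lemma conduction_formC k u v : k^T = k ->
  conduction_form k u v = conduction_form k v u.
Proof.
move=> ks; rewrite /conduction_form.
under eq_bigr do rewrite mulr_suml.
rewrite exchange_big; apply: eq_bigr => j _; rewrite mulr_suml.
by apply: eq_bigr => i _; rewrite -[in LHS]ks mxE; ring.
Qed.

(** Positivity of the form at [r u + s v], expanded. *)
Lemma conduction_form_combination k u v (r s : R) : k^T = k ->
  (forall x : 'rV[R]_3, 0 <= quad_form k x) ->
  0 <= r ^+ 2 * conduction_form k u u + 2 * r * s * conduction_form k u v +
       s ^+ 2 * conduction_form k v v.
Proof.
move=> ks pos; have := pos (\row_i (r * u i + s * v i)).
suff -> : quad_form k (\row_i (r * u i + s * v i)) =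
  r ^+ 2 * conduction_form k u u + r * s * conduction_form k u v +
  r * s * conduction_form k v u + s ^+ 2 * conduction_form k v v.
  by rewrite (conduction_formC _ _ ks); congr (0 <= _); ring.
rewrite /quad_form /conduction_form !big_ord_recl !big_ord0 !mxE; ring.
Qed.

Lemma is_derive_conduction_form k (u v : 'I_3 -> R -> R) (du dv : 'I_3 -> R)
    (t : R) :
  (forall i, is_derive t 1 (u i) (du i)) ->
  (forall i, is_derive t 1 (v i) (dv i)) ->
  is_derive t 1 (fun s => conduction_form k (u^~ s) (v^~ s))
    (conduction_form k du (v^~ t) + conduction_form k (u^~ t) dv).
Proof.
move=> hu hv; rewrite addrC -big_split /=.
apply: is_derive_bigsum => i; apply: is_derive_mul => //.
by apply: is_derive_bigsum => j; exact: is_derive_scale.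
Qed.

End conduction_form.

(** The data of this section are those of the problem with zero data, after
extension to all times: [g] stands for the temperature gradient, and [dT], [dg],
[dq], [ddq] for time derivatives.  The boundary conditions and the divergence
theorem only appear through [balance], the weak form of the energy equation, in
which the test function [T] is taken at a time [t] independent of the time [s] of
the flux.  This independence makes it possible to integrate the identity in [s]
although the primitive of [q] in time need not be differentiable in space. *)
Section energy_estimate.
Context {R : realType}.
Notation V := 'rV[R]_3.
Implicit Types (x : V) (t s : R).
Variable B : set V.
Hypotheses (oB : open B) (bB : bounded_set B).
Variables (a : V -> R) (k : V -> 'M[R]_3) (tq tT : R).
Hypotheses (ra : regular_field B (fun x _ => a x))
  (rk : forall i j, regular_field B (fun x _ => k x i j))
  (a0 : forall x, B x -> 0 < a x) (ks : forall x, B x -> (k x)^T = k x)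
  (kpos : forall x, B x -> forall v, 0 <= quad_form (k x) v)
  (tT0 : 0 < tT) (tq0 : 0 <= tq).
Variables (T dT : V -> R -> R) (g dg q dq ddq : 'I_3 -> V -> R -> R).
Hypotheses (rT : regular_field B T) (rdT : regular_field B dT)
  (rg : forall i, regular_field B (g i)) (rq : forall i, regular_field B (q i))
  (rdq : forall i, regular_field B (dq i)).
Hypotheses (cT : causal B T) (cg : forall i, causal B (g i))
  (cq : forall i, causal B (q i)) (cdq : forall i, causal B (dq i)).
Hypotheses (DT : forall x t, B x -> 0 < t -> is_derive t 1 (T x) (dT x t))
  (Dg : forall i x t, B x -> 0 < t -> is_derive t 1 (g i x) (dg i x t))
  (Dq : forall i x t, B x -> 0 < t -> is_derive t 1 (q i x) (dq i x t))
  (Ddq : forall i x t, B x -> 0 < t -> is_derive t 1 (dq i x) (ddq i x t)).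
Hypothesis constitutive : forall i x t, B x -> 0 < t ->
  q i x t + tq * dq i x t + 2^-1 * tq ^+ 2 * ddq i x t =
  - (\sum_(j < 3) k x i j * g j x t) - tT * (\sum_(j < 3) k x i j * dg j x t).
Hypothesis balance : forall t s, 0 < t -> 0 < s ->
  space_integral B
    (fun x s => \sum_(i < 3) g i x t * q i x s - a x * T x t * dT x s) s = 0.

Let z := time_primitive T.
Let y i := time_primitive (g i).
Let w i := time_primitive (y i).
Let Q i := time_primitive (q i).
Let QQ i := time_primitive (Q i).

Let cz : causal B z. Proof. exact: causal_time_primitive. Qed.
Let cy i : causal B (y i). Proof. exact: causal_time_primitive. Qed.
Let cw i : causal B (w i). Proof. exact: causal_time_primitive. Qed.
Let cQ i : causal B (Q i). Proof. exact: causal_time_primitive. Qed.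
Let cQQ i : causal B (QQ i). Proof. exact: causal_time_primitive. Qed.
Let rz : regular_field B z. Proof. exact: regular_time_primitive. Qed.
Let ry i : regular_field B (y i). Proof. exact: regular_time_primitive. Qed.
Let rw i : regular_field B (w i). Proof. exact: regular_time_primitive. Qed.
Let rQ i : regular_field B (Q i). Proof. exact: regular_time_primitive. Qed.
Let rQQ i : regular_field B (QQ i). Proof. exact: regular_time_primitive. Qed.
Let Dz x t : B x -> is_derive t 1 (z x) (T x t).
Proof. exact: is_derive_time_primitive. Qed.
Let Dy i x t : B x -> is_derive t 1 (y i x) (g i x t).
Proof. exact: is_derive_time_primitive. Qed.
Let Dw i x t : B x -> is_derive t 1 (w i x) (y i x t).
Proof. exact: is_derive_time_primitive. Qed.
Let DQ i x t : B x -> is_derive t 1 (Q i x) (q i x t).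
Proof. exact: is_derive_time_primitive. Qed.
Let DQQ i x t : B x -> is_derive t 1 (QQ i x) (Q i x t).
Proof. exact: is_derive_time_primitive. Qed.

(** The constitutive equation integrated twice in time.  The difference of the two
sides has second derivative zero, by the constitutive equation itself, and it
vanishes at time 0 with its first derivative because the initial values of [q],
[dq] and [g] are zero. *)
Lemma constitutive_integrated i x t : B x -> 0 <= t ->
  2^-1 * tq ^+ 2 * q i x t + tq * Q i x t + QQ i x t =
  - \sum_(j < 3) k x i j * (w j x t + tT * y j x t).
Proof.
move=> Bx t0.
have rK (f : 'I_3 -> V -> R -> R) : (forall j, regular_field B (f j)) ->
    regular_field B (fun x s => \sum_(j < 3) k x i j * f j x s).
  by move=> rf; apply: regular_sum => j; exact: regular_mul.
have rl (f h : 'I_3 -> V -> R -> R) : (forall j, regular_field B (f j)) ->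
    (forall j, regular_field B (h j)) ->
    regular_field B (fun x s => \sum_(j < 3) k x i j * (f j x s + tT * h j x s)).
  by move=> rf rh; apply: rK => j; apply: regular_add => //; exact: regular_scale.
(* N0 is the difference of the two sides and N1 its time derivative. *)
pose N1 x s := 2^-1 * tq ^+ 2 * dq i x s + (tq * q i x s + Q i x s) +
  \sum_(j < 3) k x i j * (y j x s + tT * g j x s).
pose N0 x s := 2^-1 * tq ^+ 2 * q i x s + (tq * Q i x s + QQ i x s) +
  \sum_(j < 3) k x i j * (w j x s + tT * y j x s).
have rN1 : regular_field B N1.
  apply: regular_add; last exact: rl.
  apply: regular_add; first exact: regular_scale.
  by apply: regular_add => //; exact: regular_scale.
have rN0 : regular_field B N0.
  apply: regular_add; last exact: rl.
  apply: regular_add; first exact: regular_scale.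
  by apply: regular_add => //; exact: regular_scale.
have N1_0 s : 0 <= s -> N1 x s = 0.
  move=> s0; apply: derive0_eq0 s0.
  - by move=> r _; exact: regular_continuous_time rN1 Bx r.
  - move=> r r0.
    have -> : (0 : R) = 2^-1 * tq ^+ 2 * ddq i x r + (tq * dq i x r + q i x r) +
        \sum_(j < 3) k x i j * (g j x r + tT * dg j x r).
      under eq_bigr do rewrite mulrDr mulrCA.
      rewrite big_split -mulr_sumr /=.
      have := constitutive i Bx r0; lra.
    apply: is_derive_add; last first.
      apply: is_derive_bigsum => j; apply: is_derive_scale.
      by apply: is_derive_add; [exact: Dy|exact/is_derive_scale/Dg].
    apply: is_derive_add; first exact/is_derive_scale/Ddq.
    by apply: is_derive_add; [exact/is_derive_scale/Dq|exact: DQ].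
  - rewrite /N1 cdq// cq// cQ// big1 ?addr0 ?mulr0 ?addr0//.
    by move=> j _; rewrite cy// cg// mulr0 addr0 mulr0.
suff : N0 x t = 0 by rewrite /N0 -addrA => /eqP; rewrite addrA addr_eq0 addrA => /eqP.
apply: derive0_eq0 t0.
- by move=> r _; exact: regular_continuous_time rN0 Bx r.
- move=> r r0; rewrite -[X in is_derive _ _ _ X](N1_0 r (ltW r0)).
  apply: is_derive_add; last first.
    apply: is_derive_bigsum => j; apply: is_derive_scale.
    by apply: is_derive_add; [exact: Dw|exact/is_derive_scale/Dy].
  apply: is_derive_add; first exact/is_derive_scale/Dq.
  by apply: is_derive_add; [exact/is_derive_scale/DQ|exact: DQQ].
- rewrite /N0 cq// cQ// cQQ// big1 ?addr0 ?mulr0 ?addr0//.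
  by move=> j _; rewrite cw// cy// mulr0 addr0 mulr0.
Qed.

(** The integrand of the energy identity: the temperature is frozen at time [t],
while the flux [p] and the heat content [S] run with [s]. *)
Definition pairing (t : R) (p : 'I_3 -> V -> R -> R) (S : V -> R -> R) x s : R :=
  \sum_(i < 3) g i x t * p i x s - a x * T x t * S x s.

Lemma regular_pairing t p S : (forall i, regular_field B (p i)) ->
  regular_field B S -> regular_field B (pairing t p S).
Proof.
move=> rp rS; apply: regular_add.
  by apply: regular_sum => i; apply: regular_mul => //; exact: regular_freeze.
rewrite (_ : (fun _ _ => _) = fun x s => -1 * (a x * T x t * S x s)).
  apply: regular_scale; apply: regular_mul => //; apply: regular_mul => //.
  exact: regular_freeze.
by apply/funext => x; apply/funext => s; rewrite mulN1r.
Qed.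

(** The energy identity is inherited by primitives in time of the flux and of the
heat content, both sides being zero at time 0. *)
Lemma pairing_primitive t p dp S dS : 0 < t ->
  (forall i, regular_field B (p i)) -> (forall i, regular_field B (dp i)) ->
  regular_field B S -> regular_field B dS ->
  (forall i, causal B (p i)) -> causal B S ->
  (forall i x s, B x -> 0 < s -> is_derive s 1 (p i x) (dp i x s)) ->
  (forall x s, B x -> 0 < s -> is_derive s 1 (S x) (dS x s)) ->
  (forall s, 0 < s -> space_integral B (pairing t dp dS) s = 0) ->
  forall s, 0 <= s -> space_integral B (pairing t p S) s = 0.
Proof.
move=> t0 rp rdp rS rdS cp cS Dp DS int0 s s0; apply: derive0_eq0 s0.
- move=> r _; apply: space_integral_continuous => //; exact: regular_pairing.
- move=> r r0; rewrite -(int0 r r0).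
  apply: is_derive_space_integral => //; try exact: regular_pairing.
  move=> x r' Bx r'0; apply: is_deriveB.
    by apply: is_derive_bigsum => i; apply: is_derive_scale; exact: Dp.
  exact/is_derive_scale/DS.
- apply: space_integral0 => x Bx; rewrite /pairing cS// mulr0 subr0.
  by rewrite big1// => i _; rewrite cp// mulr0.
Qed.

Let K x (u v : 'I_3 -> V -> R -> R) t :=
  conduction_form (k x) (fun i => u i x t) (fun i => v i x t).

Let rK u v : (forall i, regular_field B (u i)) ->
  (forall i, regular_field B (v i)) ->
  regular_field B (fun x t => K x u v t).
Proof.
move=> ru rv; apply: regular_sum => i; apply: regular_mul => //.
by apply: regular_sum => j; exact: regular_mul.
Qed.

(** Testing the twice integrated equation with [T = z'] produces the first line and
[tT K(y,y)].  The power of [K(g,w)] has no sign; it is the derivative of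
[K(y,w)] up to [K(y,y)], hence the term [2 K(y,w)], and the multiple of [K(w,w)]
restores positivity. *)
Definition energy x t : R :=
  2^-1 * tq ^+ 2 * (a x * (T x t * T x t)) + a x * (z x t * z x t) +
  (tT * K x y y t + 2 * K x y w t + 4 / tT * K x w w t).

Definition energy_rate x t : R :=
  2^-1 * tq ^+ 2 * (a x * (dT x t * T x t + T x t * dT x t)) +
  a x * (T x t * z x t + z x t * T x t) +
  (tT * (K x g y t + K x y g t) + 2 * (K x g w t + K x y y t) +
   4 / tT * (K x y w t + K x w y t)).

Lemma is_derive_energy x t : B x -> 0 < t ->
  is_derive t 1 (energy x) (energy_rate x t).
Proof.
move=> Bx t0; have hT := DT Bx t0; have hz := Dz t Bx.
have hy i := Dy i t Bx; have hw i := Dw i t Bx.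
have hK (u v du dv : 'I_3 -> V -> R -> R) :
    (forall i, is_derive t 1 (u i x) (du i x t)) ->
    (forall i, is_derive t 1 (v i x) (dv i x t)) ->
    is_derive t 1 (K x u v) (K x du v t + K x u dv t).
  by move=> hu hv; exact: (is_derive_conduction_form (k x) hu hv).
have hTT := is_derive_scale (2^-1 * tq ^+ 2) (is_derive_scale (a x) (is_derive_mul hT hT)).
have hzz := is_derive_scale (a x) (is_derive_mul hz hz).
have hyy := is_derive_scale tT (hK _ _ _ _ hy hy).
have hyw := is_derive_scale 2 (hK _ _ _ _ hy hw).
have hww := is_derive_scale (4 / tT) (hK _ _ _ _ hw hw).
exact: (is_derive_add (is_derive_add hTT hzz) (is_derive_add (is_derive_add hyy hyw) hww)).
Qed.

Let KC x u v t : B x -> K x u v t = K x v u t.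
Proof. by move=> Bx; apply: conduction_formC; exact: ks. Qed.

Let Kpos x u v t (r s : R) : B x ->
  0 <= r ^+ 2 * K x u u t + 2 * r * s * K x u v t + s ^+ 2 * K x v v t.
Proof.
by move=> Bx; apply: conduction_form_combination; [exact: ks|exact: kpos].
Qed.

Let Kge0 x u t : B x -> 0 <= K x u u t.
Proof.
move=> Bx; have := Kpos u u t 1 0 Bx.
by rewrite expr1n expr0n /= mulr0 !mul0r mul1r !addr0.
Qed.

Let asq_ge0 x (r : R) : B x -> 0 <= a x * (r * r).
Proof.
by move=> Bx; apply: mulr_ge0; [exact/ltW/a0|rewrite -expr2 sqr_ge0].
Qed.

(** The square of [tT y + 2 w] in the conduction form absorbs the cross term. *)
Lemma energy_ge x t : B x ->
  a x * (z x t * z x t) + (tT / 2 * K x y y t + 2 / tT * K x w w t) <=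
  energy x t.
Proof.
move=> Bx; rewrite /energy.
have tTi : 0 < tT^-1 by rewrite invr_gt0.
have tTV : tT * tT^-1 = 1 by rewrite divff// gt_eqF.
have := mulr_ge0 (ltW tTi) (Kpos y w t tT 2 Bx).
have -> : tT^-1 * (tT ^+ 2 * K x y y t + 2 * tT * 2 * K x y w t +
    2 ^+ 2 * K x w w t) =
  (tT * tT^-1) * (tT * K x y y t + 4 * K x y w t) + 4 * tT^-1 * K x w w t by ring.
rewrite tTV mul1r.
have : 0 <= 2^-1 * tq ^+ 2 * (a x * (T x t * T x t)).
  apply: mulr_ge0; last exact: asq_ge0.
  by apply: mulr_ge0; [rewrite invr_ge0|exact: sqr_ge0].
lra.
Qed.

(* Large enough for the growth rate: [M tT / 2 >= 2 + 4 / tT] controls [K(y,y)] and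
   [2 M / tT >= 4 / tT] controls [K(w,w)]. *)
Let M : R := 2 * (2 + 4 / tT) / tT + 2.

(** Up to the terms [pairing], whose integrals vanish, the rate of the energy is
[2 K(y,y) + (8 / tT) K(y,w)] minus a nonnegative term: the power
[K(g,w) + tT K(g,y)] is rewritten with the integrated constitutive equation as
a pairing of [g] with [q], [Q] and [QQ]. *)
Lemma energy_rate_le x t : B x -> 0 <= t ->
  energy_rate x t <= M * energy x t +
    (- (tq ^+ 2) * pairing t q dT x t +
     (- (2 * tq) * pairing t Q T x t + - 2 * pairing t QQ z x t)).
Proof.
move=> Bx t0.
have tTi : 0 < tT^-1 by rewrite invr_gt0.
have tTV : tT * tT^-1 = 1 by rewrite divff// gt_eqF.
have flux : 2^-1 * tq ^+ 2 * (\sum_(i < 3) g i x t * q i x t) +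
    tq * (\sum_(i < 3) g i x t * Q i x t) + \sum_(i < 3) g i x t * QQ i x t =
    - (K x g w t + tT * K x g y t).
  rewrite !mulr_sumr -!big_split /= -sumrN; apply: eq_bigr => i _.
  have := constitutive_integrated i Bx t0.
  have -> : \sum_(j < 3) k x i j * (w j x t + tT * y j x t) =
    \sum_(j < 3) k x i j * w j x t + tT * \sum_(j < 3) k x i j * y j x t.
    rewrite mulr_sumr -big_split; apply: eq_bigr => j _ /=; ring.
  move=> h; transitivity (g i x t *
    (2^-1 * tq ^+ 2 * q i x t + tq * Q i x t + QQ i x t)); first by ring.
  rewrite h; ring.
have yy := Kge0 y t Bx; have ww := Kge0 w t Bx.
have yw : 0 <= K x y y t - 2 * K x y w t + K x w w t.
  have := Kpos y w t 1 (-1) Bx.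
  by congr (0 <= _); ring.
have az := asq_ge0 (z x t) Bx.
have aT : 0 <= tq * (a x * (T x t * T x t)).
  by apply: mulr_ge0 => //; exact: asq_ge0.
have M0 : 0 <= M by rewrite /M addr_ge0// !mulr_ge0 ?addr_ge0 ?mulr_ge0// ltW.
have := ler_wpM2l M0 (energy_ge t Bx).
suff : energy_rate x t <=
    M * (a x * (z x t * z x t) + (tT / 2 * K x y y t + 2 / tT * K x w w t)) +
    (- (tq ^+ 2) * pairing t q dT x t +
     (- (2 * tq) * pairing t Q T x t + - 2 * pairing t QQ z x t)).
  by move=> h1 h2; apply: (le_trans h1); rewrite lerD2r.
have key : 2 * K x y y t + 8 / tT * K x y w t <=
    M * (tT / 2 * K x y y t + 2 / tT * K x w w t).
  have -> : M * (tT / 2 * K x y y t + 2 / tT * K x w w t) =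
    (tT * tT^-1) * (2 + 4 * tT^-1) * K x y y t + tT * K x y y t +
    (8 * (2 + 4 * tT^-1) * tT^-1 * tT^-1 / 2 + 4 * tT^-1) * K x w w t.
    by rewrite /M; field; rewrite gt_eqF.
  rewrite tTV mul1r.
  have h1 := mulr_ge0 (ltW tTi) yw.
  have h2 : 0 <= tT * K x y y t by apply: mulr_ge0 => //; exact: ltW.
  have h3 : 0 <= 8 * (2 + 4 * tT^-1) * tT^-1 * tT^-1 / 2 * K x w w t.
    apply: mulr_ge0 => //.
    by rewrite !mulr_ge0 ?invr_ge0// ltW// addr_gt0// mulr_gt0.
  lra.
rewrite /energy_rate /pairing (KC y g)// (KC w y)// [M * (_ + _)]mulrDr.
have Maz := mulr_ge0 M0 az.
lra.
Qed.

Let regular_energy : regular_field B energy.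
Proof.
have rsq (u v : V -> R -> R) : regular_field B u -> regular_field B v ->
    regular_field B (fun x t => a x * (u x t * v x t)).
  by move=> ru rv; apply: regular_mul => //; exact: regular_mul.
apply: regular_add; first by apply: regular_add; [apply: regular_scale|]; exact: rsq.
by apply: regular_add; [apply: regular_add|]; apply: regular_scale; exact: rK.
Qed.

Let regular_energy_rate : regular_field B energy_rate.
Proof.
have rsq (u v : V -> R -> R) : regular_field B u -> regular_field B v ->
    regular_field B (fun x t => a x * (u x t * v x t + v x t * u x t)).
  move=> ru rv; apply: regular_mul => //.
  by apply: regular_add; exact: regular_mul.
apply: regular_add; first by apply: regular_add; [apply: regular_scale|]; exact: rsq.
by apply: regular_add; [apply: regular_add|]; apply: regular_scale;
  apply: regular_add; exact: rK.
Qed.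

Lemma space_integral_energy_le0 t : 0 <= t -> space_integral B energy t <= 0.
Proof.
move=> t0; apply: (@gronwall _ _ (space_integral B energy_rate) M) t0.
- by move=> s _; exact: space_integral_continuous.
- move=> s s0; exact: (is_derive_space_integral oB bB regular_energy
    regular_energy_rate s0 is_derive_energy).
- move=> s s0.
  have b1 r : 0 < r -> space_integral B (pairing s q dT) r = 0.
    by move=> r0; exact: balance.
  have b2 r : 0 <= r -> space_integral B (pairing s Q T) r = 0.
    by apply: (@pairing_primitive s Q q T dT) => // *; exact: DQ.
  have b3 r : 0 <= r -> space_integral B (pairing s QQ z) r = 0.
    apply: (@pairing_primitive s QQ Q z T) => //.
    - by move=> *; exact: DQQ.
    - by move=> *; exact: Dz.
    - by move=> p /ltW; exact: b2.
  have r1 := regular_pairing s rq rdT.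
  have r2 := regular_pairing s rQ rT.
  have r3 := regular_pairing s rQQ rz.
  pose D x r := M * energy x r + (- (tq ^+ 2) * pairing s q dT x r +
     (- (2 * tq) * pairing s Q T x r + - 2 * pairing s QQ z x r)).
  have r23 : regular_field B (fun x r =>
      - (2 * tq) * pairing s Q T x r + - 2 * pairing s QQ z x r).
    by apply: regular_add; exact: regular_scale.
  have r123 : regular_field B (fun x r => - (tq ^+ 2) * pairing s q dT x r +
     (- (2 * tq) * pairing s Q T x r + - 2 * pairing s QQ z x r)).
    by apply: regular_add => //; exact: regular_scale.
  have rM := regular_scale M regular_energy.
  have -> : M * space_integral B energy s = space_integral B D s.
    have e1 := space_integral_add oB bB s rM r123.
    have e2 := space_integral_add oB bB s
      (regular_scale (- (tq ^+ 2)) r1) r23.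
    have e3 := space_integral_add oB bB s
      (regular_scale (- (2 * tq)) r2) (regular_scale (- 2) r3).
    rewrite /D e1 e2 e3 !space_integral_scale//.
    by rewrite b1// b2 ?ltW// b3 ?ltW// !mulr0 !addr0.
  apply: (space_integral_le oB bB regular_energy_rate (regular_add rM r123)).
  by move=> x Bx; apply: energy_rate_le => //; exact: ltW.
- apply: space_integral0 => x Bx; rewrite /energy cT// cz// !mulr0 !add0r.
  have K0 (u v : 'I_3 -> V -> R -> R) : (forall i, causal B (u i)) ->
      K x v u 0 = 0.
    move=> cu; rewrite /K /conduction_form big1// => i _.
    by rewrite big1 ?mul0r// => j _; rewrite cu// mulr0.
  by rewrite !K0// !mulr0 !addr0.
Qed.

Lemma temperature_eq0 x t : B x -> 0 <= t -> T x t = 0.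
Proof.
move=> Bx; rewrite le_eqVlt => /predU1P[<-|t0]; first exact: cT.
have z0 s : 0 <= s -> z x s = 0.
  move=> s0; have rE : regular_field B (fun x s => a x * (z x s * z x s)).
    by apply: regular_mul => //; exact: regular_mul.
  have pos x' : B x' -> 0 <= a x' * (z x' s * z x' s).
    exact: asq_ge0.
  have /eqP : a x * (z x s * z x s) = 0.
    apply: (@space_integral_eq0 _ B oB bB (fun x s => a x * (z x s * z x s))) => //.
    apply: le_trans (space_integral_energy_le0 s0).
    apply: space_integral_le => // x' Bx'; apply: le_trans (energy_ge s Bx').
    rewrite lerDl addr_ge0// mulr_ge0//.
    + by rewrite ltW// divr_gt0.
    + exact: Kge0.
    + by rewrite ltW// divr_gt0.
    + exact: Kge0.
  by rewrite !mulf_eq0 orbb gt_eqF ?a0//= => /eqP.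
have : is_derive t 1 (z x) 0.
  apply: near_eq_is_derive (is_derive_cst (0 : R) t 1).
  by near=> s; apply/esym/z0/ltW; near: s; exact: lt_nbhsr.
by have [_ <-] := Dz t Bx; case=> _ ->.
Unshelve. all: by end_near. Qed.

End energy_estimate.

(** * Reduction to zero data *)

Section linearity.
Context {R : realType}.
Notation V := 'rV[R]_3.
Implicit Types (f g : V -> R -> R) (A B : set V) (x : V) (t s : R).

(** The pointwise derivatives of a difference are the differences of the derivatives
only at interior points and positive times; this is enough, since the equations
and the smoothness conditions only look there. *)
Definition agree_inside B f g : Prop :=
  forall x t, B x -> 0 < t -> f x t = g x t.

Definition fsub f g : V -> R -> R := fun x t => f x t - g x t.

Lemma cont_on_sub A (I : set R) f g :
  cont_on A I f -> cont_on A I g -> cont_on A I (fsub f g).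
Proof. by move=> cf cg p; exact: (cvgB (cf p) (cg p)). Qed.

Lemma eq_cont_on A (I : set R) f g :
  (forall x t, A x -> I t -> f x t = g x t) -> cont_on A I f -> cont_on A I g.
Proof.
move=> fg; apply: subspace_eq_continuous => -[x t].
by rewrite inE => -[/= Ax It]; exact: fg.
Qed.

Lemma agree_cont_on B f g : agree_inside B f g ->
  cont_on B `]0, +oo[ f -> cont_on B `]0, +oo[ g.
Proof.
by move=> fg; apply: eq_cont_on => x t Bx; rewrite /= in_itv/= andbT; exact: fg.
Qed.

Lemma near_agree_time B f g x t : agree_inside B f g -> B x -> 0 < t ->
  \forall s \near t, f x s = g x s.
Proof.
by move=> fg Bx t0; near=> s; apply: fg => //; near: s; exact: lt_nbhsr.
Unshelve. all: by end_near. Qed.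

Lemma agree_dt B f g : agree_inside B f g -> agree_inside B (dt f) (dt g).
Proof.
move=> fg x t Bx t0; rewrite /dt !derive1E; apply: near_eq_derive.
exact: near_agree_time fg Bx t0.
Qed.

Lemma agree_has_dt B f g : agree_inside B f g -> has_dt B f -> has_dt B g.
Proof.
move=> fg hf x t Bx t0; apply: near_eq_derivable (hf x t Bx t0).
exact: near_agree_time fg Bx t0.
Qed.

Lemma has_dt_sub B f g : has_dt B f -> has_dt B g -> has_dt B (fsub f g).
Proof.
by move=> hf hg x t Bx t0; apply: derivableB; [exact: hf|exact: hg].
Qed.

Lemma dt_sub B f g : has_dt B f -> has_dt B g ->
  agree_inside B (fsub (dt f) (dt g)) (dt (fsub f g)).
Proof.
move=> hf hg x t Bx t0; rewrite /fsub /dt !derive1E -deriveB//;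
  [exact: hf|exact: hg].
Qed.

Lemma has_dx_sub B i f g : has_dx B i f -> has_dx B i g -> has_dx B i (fsub f g).
Proof.
by move=> hf hg x t Bx t0; apply: derivableB; [exact: hf|exact: hg].
Qed.

Lemma dx_sub B i f g : has_dx B i f -> has_dx B i g ->
  agree_inside B (fsub (dx i f) (dx i g)) (dx i (fsub f g)).
Proof.
by move=> hf hg x t Bx t0; rewrite /fsub /dx /partial -deriveB//;
  [exact: hf|exact: hg].
Qed.

Lemma up_to_bdry_sub B f g h : agree_inside B (fsub f g) h ->
  continuous_up_to_bdry B f -> continuous_up_to_bdry B g ->
  continuous_up_to_bdry B h.
Proof.
move=> fgh [f' cf ef] [g' cg eg]; exists (fsub f' g'); first exact: cont_on_sub.
by move=> x t Bx t0; rewrite -fgh// /fsub ef// eg.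
Qed.

Lemma C11_sub B f g : C11 B f -> C11 B g -> C11 B (fsub f g).
Proof.
move=> [f0 f1 f2 f3] [g0 g1 g2 g3]; split.
- exact: cont_on_sub.
- exact: has_dt_sub.
- by apply: agree_cont_on (dt_sub f1 g1) _; exact: cont_on_sub.
- move=> j; have [f4 f5 f6 f7] := f3 j; have [g4 g5 g6 g7] := g3 j.
  have e := dx_sub f4 g4; split.
  + exact: has_dx_sub.
  + by apply: agree_cont_on e _; exact: cont_on_sub.
  + by apply: agree_has_dt e _; exact: has_dt_sub.
  + apply: agree_cont_on (agree_dt e) _.
    by apply: agree_cont_on (dt_sub f6 g6) _; exact: cont_on_sub.
Qed.

Lemma C12_sub B f g : C12 B f -> C12 B g -> C12 B (fsub f g).
Proof.
move=> [f0 f1 [f2 f3] [f4 f5]] [g0 g1 [g2 g3] [g4 g5]]; split.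
- exact: cont_on_sub.
- move=> j; have [f6 f7] := f1 j; have [g6 g7] := g1 j; split.
    exact: has_dx_sub.
  by apply: agree_cont_on (dx_sub f6 g6) _; exact: cont_on_sub.
- split; first exact: has_dt_sub.
  by apply: agree_cont_on (dt_sub f2 g2) _; exact: cont_on_sub.
- have e := dt_sub f2 g2; split.
    by apply: agree_has_dt e _; exact: has_dt_sub.
  apply: agree_cont_on (agree_dt e) _.
  by apply: agree_cont_on (dt_sub f4 g4) _; exact: cont_on_sub.
Qed.

Definition zero_data : data R :=
  Data (fun _ _ => 0) (fun _ => 0) (fun _ => 0) (fun _ => 0) (fun _ _ => 0)
    (fun _ _ => 0).

Lemma component_sub (q1 q2 : V -> R -> V) i :
  component (fun x t => q1 x t - q2 x t) i =
  fsub (component q1 i) (component q2 i).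
Proof. by apply/funext => x; apply/funext => t; rewrite /component !mxE. Qed.

Lemma dot_subl (u v n : V) : dot (u - v) n = dot u n - dot v n.
Proof.
by rewrite /dot -sumrB; apply: eq_bigr => i _; rewrite !mxE mulrBl.
Qed.

Lemma is_solution_sub B S1 S2 c d T1 T2 (q1 q2 : V -> R -> V) :
  is_solution B S1 S2 c d T1 q1 -> is_solution B S1 S2 c d T2 q2 ->
  is_solution B S1 S2 c zero_data (fsub T1 T2) (fun x t => q1 x t - q2 x t).
Proof.
move=> h1 h2.
have [_ T1t _ T1x] := temp_C11 h1; have [_ T2t _ T2x] := temp_C11 h2.
have eT := dt_sub T1t T2t.
have exT j : agree_inside B (fsub (dx j T1) (dx j T2)) (dx j (fsub T1 T2)).
  by have [? _ _ _] := T1x j; have [? _ _ _] := T2x j; exact: dx_sub.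
have extT j : agree_inside B (fsub (dt (dx j T1)) (dt (dx j T2)))
    (dt (dx j (fsub T1 T2))).
  move=> x t Bx t0; rewrite -(agree_dt (exT j))//.
  have [_ _ a1 _] := T1x j; have [_ _ a2 _] := T2x j.
  by rewrite -(dt_sub a1 a2).
have eq_ i : agree_inside B (fsub (dt (component q1 i)) (dt (component q2 i)))
    (dt (fsub (component q1 i) (component q2 i))).
  have [_ _ [a1 _] _] := flux_C12 h1 i; have [_ _ [a2 _] _] := flux_C12 h2 i.
  exact: dt_sub.
have eqq i : agree_inside B
    (fsub (dt (dt (component q1 i))) (dt (dt (component q2 i))))
    (dt (dt (fsub (component q1 i) (component q2 i)))).
  move=> x t Bx t0; rewrite -(agree_dt (eq_ i))//.
  have [_ _ _ [a1 _]] := flux_C12 h1 i; have [_ _ _ [a2 _]] := flux_C12 h2 i.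
  by rewrite -(dt_sub a1 a2).
have ediv : agree_inside B
    (fsub (fun x t => \sum_(i < 3) dx i (component q1 i) x t)
       (fun x t => \sum_(i < 3) dx i (component q2 i) x t))
    (fun x t => \sum_(i < 3) dx i (fsub (component q1 i) (component q2 i)) x t).
  move=> x t Bx t0; rewrite /fsub -sumrB; apply: eq_bigr => i _.
  have [_ a1 _ _] := flux_C12 h1 i; have [_ a2 _ _] := flux_C12 h2 i.
  by rewrite -(dx_sub (a1 i).1 (a2 i).1).
split.
- by apply: C11_sub; [exact: temp_C11 h1|exact: temp_C11 h2].
- move=> i; rewrite component_sub; apply: C12_sub;
    [exact: flux_C12 h1 i|exact: flux_C12 h2 i].
- have [a1 a2 a3] := temp_classical h1; have [b1 b2 b3] := temp_classical h2.
  split; first exact: cont_on_sub.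
    exact: up_to_bdry_sub eT a2 b2.
  move=> j; have [a4 a5] := a3 j; have [b4 b5] := b3 j; split.
    exact: up_to_bdry_sub (exT j) a4 b4.
  exact: up_to_bdry_sub (extT j) a5 b5.
- have [a1 a2] := flux_classical h1; have [b1 b2] := flux_classical h2; split.
    move=> i; have [a3 a4 a5] := a1 i; have [b3 b4 b5] := b1 i.
    rewrite component_sub; split; first exact: cont_on_sub.
      exact: up_to_bdry_sub (eq_ i) a4 b4.
    exact: up_to_bdry_sub (eqq i) a5 b5.
  under eq_fun do under eq_fun do under eq_bigr do rewrite component_sub.
  exact: up_to_bdry_sub ediv a2 b2.
- move=> x t i Bx t0; rewrite component_sub -(eq_ i)// -(eqq i)// /fsub.
  have e1 := constitutive_eq h1 i Bx t0; have e2 := constitutive_eq h2 i Bx t0.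
  have -> : \sum_(j < 3) conductivity c x i j * dx j (fsub T1 T2) x t =
      \sum_(j < 3) conductivity c x i j * dx j T1 x t -
      \sum_(j < 3) conductivity c x i j * dx j T2 x t.
    by rewrite -sumrB; apply: eq_bigr => j _; rewrite -(exT j)// mulrBr.
  have -> : \sum_(j < 3) conductivity c x i j * dt (dx j (fsub T1 T2)) x t =
      \sum_(j < 3) conductivity c x i j * dt (dx j T1) x t -
      \sum_(j < 3) conductivity c x i j * dt (dx j T2) x t.
    by rewrite -sumrB; apply: eq_bigr => j _; rewrite -(extT j)// mulrBr.
  have arith (u1 v1 w1 s1 r1 u2 v2 w2 s2 r2 p p' p'' : R) :
      u1 + p * v1 + p' * w1 = - s1 - p'' * r1 ->
      u2 + p * v2 + p' * w2 = - s2 - p'' * r2 ->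
      u1 - u2 + p * (v1 - v2) + p' * (w1 - w2) = - (s1 - s2) - p'' * (r1 - r2).
    move=> e e'; transitivity (u1 + p * v1 + p' * w1 - (u2 + p * v2 + p' * w2)).
      ring.
    rewrite e e'; ring.
  exact: arith e1 e2.
- move=> x t Bx t0; under eq_bigr do rewrite component_sub.
  rewrite -ediv// -(eT x t)// /fsub mulr0 addr0.
  have := energy_eq h1 Bx t0; have := energy_eq h2 Bx t0; lra.
- by move=> x Bx; rewrite /fsub (temp_init h1 Bx) (temp_init h2 Bx) subrr.
- by move=> x Bx; rewrite (flux_init h1 Bx) (flux_init h2 Bx) subrr.
- move=> x i Bx; rewrite component_sub /= mxE.
  have f1 := @flux_rate_init _ _ _ _ _ _ _ _ h1 x i Bx.
  have f2 := @flux_rate_init _ _ _ _ _ _ _ _ h2 x i Bx.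
  have := cvgB f1 f2.
  rewrite subrr => lim0.
  have E : (fun h : R => h^-1 * (fsub (component q1 i) (component q2 i) x h -
      fsub (component q1 i) (component q2 i) x 0)) =
    (fun h : R => h^-1 * (component q1 i x h - component q1 i x 0) -
                  h^-1 * (component q2 i x h - component q2 i x 0)).
    by apply/funext => h; rewrite /fsub; ring.
  by rewrite E; exact: lim0.
- by move=> x t Sx t0; rewrite /fsub (temp_bc h1 Sx t0) (temp_bc h2 Sx t0) subrr.
- move=> x t n Sx On t0.
  by rewrite dot_subl (flux_bc h1 Sx On t0) (flux_bc h2 Sx On t0) subrr.
Qed.

End linearity.

(** * Extension of fields to all times *)

Section extension_to_all_times.
Context {R : realType}.
Notation V := 'rV[R]_3.
Implicit Types (f g : V -> R -> R) (A B : set V) (x : V) (t s : R).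

(** Extends a field known for [t >= 0] by its initial value. *)
Definition clamp f : V -> R -> R := fun x t => f x (Num.max t 0).

Lemma clampE f x t : 0 <= t -> clamp f x t = f x t.
Proof. by move=> t0; rewrite /clamp max_l. Qed.

Lemma clamp_causal B f : (forall x, B x -> f x 0 = 0) -> causal B (clamp f).
Proof. by move=> f0 x t Bx t0; rewrite /clamp max_r// f0. Qed.

Lemma bounded_closure B : bounded_set B -> bounded_set (closure B).
Proof.
move=> [M [Mr hM]]; exists M; split => // b Mb.
have cl : closed [set x : V | `|x| <= b].
  apply: (@closed_comp _ _ (fun x : V => `|x|) [set r | r <= b]).
    by move=> x _; exact: norm_continuous.
  exact: closed_le.
by move=> x /(closureS (hM b Mb)); rewrite -(closure_id _).1.
Qed.

Lemma clamp_regular B f : open B -> bounded_set B ->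
  cont_on (closure B) `[0, +oo[ f -> regular_field B (clamp f).
Proof.
move=> oB bB cf; split.
  move=> x t Bx.
  have /subspace_continuousP/(_ (x, Num.max t 0)) cfx := cf.
  have /cfx : (closure B `*` `[0, +oo[) (x, Num.max t 0).
    split => /=; first exact: subset_closure.
    by rewrite in_itv/= andbT le_max lexx orbT.
  move=> {cfx} cfx U /cfx; rewrite /within/= => nU.
  have cc : {for (x, t), continuous (fun p : V * R => (p.1, Num.max p.2 0))}.
    apply: (@continuous_pair _ _ _ fst (fun p : V * R => Num.max p.2 0)).
      exact: cvg_fst.
    apply: (@continuous_comp _ _ _ snd (fun s : R => Num.max s 0)).
      exact: cvg_snd.
    by apply: continuous_max; [exact: cvg_id|exact: cvg_cst].
  have n1 : \forall p \near (x, t), (closure B `*` `[0, +oo[)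
      (p.1, Num.max p.2 0) -> U (f p.1 (Num.max p.2 0)) := cc _ nU.
  have n2 : \forall p \near (x, t), B p.1.
    exact: (@cvg_fst _ _ (nbhs x) (nbhs t) _ _ (open_nbhs_nbhs (conj oB Bx))).
  suff : \forall p \near (x, t), U (clamp f p.1 p.2) by [].
  apply: filterS2 n1 n2 => -[y s]/= h By; apply: h; split => /=.
    exact: subset_closure.
  by rewrite in_itv/= andbT le_max lexx orbT.
move=> b.
have cK : compact (closure B `*` `[0, Num.max b 0]%classic).
  apply: compact_setX; last exact: segment_compact.
  apply: bounded_closed_compact; first exact: bounded_closure.
  exact: closed_closure.
have cfK : {within closure B `*` `[0, Num.max b 0]%classic,
    continuous (fun p : V * R => f p.1 p.2)}.
  apply: continuous_subspaceW cf => -[x s]/= [Bx]; rewrite !in_itv/= andbT.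
  by move=> /andP[].
have [M [_ hM]] := compact_bounded (continuous_compact cfK cK).
exists (M + 1) => x t Bx tb; apply: hM; first by rewrite ltrDl.
exists (x, Num.max t 0) => //; split => /=; first exact: subset_closure.
rewrite in_itv/= le_max lexx orbT /= ge_max le_max (le_trans (ler_norm t) tb) /=.
by rewrite le_max lexx orbT.
Qed.

Lemma is_derive_clamp f (df : R) x t : 0 < t -> is_derive t 1 (f x) df ->
  is_derive t 1 (clamp f x) df.
Proof.
move=> t0; apply: near_eq_is_derive; near=> s.
by rewrite clampE//; apply: ltW; near: s; exact: lt_nbhsr.
Unshelve. all: by end_near. Qed.

Lemma is_derive_extension B (f g g' : V -> R -> R) x t : has_dt B f ->
  agree_inside B g f -> agree_inside B g' (dt f) -> B x -> 0 < t ->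
  is_derive t 1 (clamp g x) (clamp g' x t).
Proof.
move=> hf eg eg' Bx t0; rewrite (clampE _ _ (ltW t0)) eg'//.
apply: is_derive_clamp => //; apply: (@near_eq_is_derive _ _ _ (f x)).
  by near=> s; apply/esym/eg => //; near: s; exact: lt_nbhsr.
by rewrite /dt derive1E; apply: DeriveDef => //; exact: hf.
Unshelve. all: by end_near. Qed.

Lemma closure_eq0 B f x t : cont_on (closure B) `[0, +oo[ f ->
  (forall y, B y -> f y t = 0) -> closure B x -> 0 <= t -> f x t = 0.
Proof.
move=> cf f0 Bx t0; apply/eqP/negPn/negP => fx.
have /subspace_continuousP/(_ (x, t)) cfx := cf.
have /cfx : (closure B `*` `[0, +oo[) (x, t) by split => //=; rewrite in_itv/= t0.
move/cvgrPdist_lt => /(_ `|f x t|); rewrite normr_gt0 => /(_ fx).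
rewrite /within /= => -[[U W] /= [nU nW] UW].
have [y [By Uy]] := Bx _ nU.
have := UW (y, t); rewrite /from_subspace /= (f0 y By) subr0 ltxx => h.
suff : false by [].
apply: h; first by split => //; exact: nbhs_singleton.
by split; [exact: subset_closure|rewrite in_itv/= t0].
Qed.

(** By the mean value theorem, the difference quotient at 0 is a value of the
derivative [p] at a small positive time. *)
Lemma right_derivative_limit (u p : R -> R) (l : R) :
  continuous u -> {for 0, continuous p} ->
  (forall s, 0 < s -> is_derive s 1 u (p s)) ->
  h^-1 * (u h - u 0) @[h --> 0^'+] --> l -> p 0 = l.
Proof.
move=> cu cp Du lim; apply: cvg_unique lim => //.
apply/cvgrPdist_lt => e e0.
have := cp; move/cvgrPdist_lt => /(_ e e0).
rewrite -nbhs_ballE => -[/= d d0 hd].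
near=> h.
have h0 : 0 < h by near: h; exact: nbhs_right_gt.
have hd' : h < d by near: h; exact: nbhs_right_lt.
have Du' s : s \in `]0, h[%R -> is_derive s 1 u (p s).
  by rewrite in_itv/= => /andP[s0 _]; exact: Du.
have [c] := MVT h0 Du' (continuous_subspaceT cu).
rewrite in_itv/= subr0 => /andP[c0 ch] ->.
rewrite mulrC mulfK ?gt_eqF//; apply: hd.
by rewrite /ball/= sub0r normrN gtr0_norm// (lt_trans ch).
Unshelve. all: by end_near. Qed.

Lemma is_derive_line f i x t (r : R) (df : R) :
  derivable (f^~ t) (x + r *: delta_mx 0 i) (delta_mx 0 i) ->
  is_derive r 1 (fun h : R => f (x + h *: delta_mx 0 i) t)
    (dx i f (x + r *: delta_mx 0 i) t).
Proof.
rewrite /dx /partial => df'; set e : V := delta_mx 0 i in df' *.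
have E : (fun h : R => h^-1 *: (f ((h *: (1 : R) + r) *: e + x) t -
    f (r *: e + x) t)) =
  (fun h => h^-1 *: (f (h *: e + (x + r *: e)) t - f (x + r *: e) t)).
  apply/funext => h; rewrite scaler1 scalerDl -addrA [r *: e + x]addrC.
  by [].
have E' : (fun h : R => f (x + h *: e) t) = (fun h : R => f (h *: e + x) t).
  by apply/funext => h; rewrite addrC.
rewrite E'; apply: DeriveDef.
  by rewrite /derivable /= E; exact: df'.
by rewrite /derive /= E.
Qed.

(** The gradient [g] extends continuously to [t = 0], and its value there is the
gradient of the initial value of [f].  If [g x 0] were nonzero, the increment of
[f] along a short segment from [x] would be bounded below uniformly for small
positive times, whereas it tends to 0. *)
Lemma gradient_initial B i f g : open B ->
  regular_field B f -> regular_field B g ->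
  (forall x, B x -> f x 0 = 0) ->
  (forall x t, B x -> 0 < t -> is_derive x (delta_mx 0 i) (f^~ t) (g x t)) ->
  forall x, B x -> g x 0 = 0.
Proof.
move=> oB rf rg f0 fg x Bx; apply/eqP/negPn/negP => gx.
pose e : V := delta_mx 0 i.
(* Near (x, 0) the derivative along e stays within c of a value of modulus 2c. *)
pose c := `|g x 0| / 2.
have c0 : 0 < c by rewrite /c divr_gt0// normr_gt0.
have cl : continuous (fun r : R => x + r *: e).
  by move=> r; apply: cvgD; [exact: cvg_cst|exact: scalel_continuous].
have line0 : x + 0 *: e = x by rewrite scale0r addr0.
have n1 : \forall p \near (0 : R, 0 : R), B (x + p.1 *: e).
  apply: (@cvg_fst _ _ (nbhs (0 : R)) (nbhs (0 : R)) _
    [set r | B (x + r *: e)]).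
  by apply: cl; rewrite line0; exact: open_nbhs_nbhs.
have n2 : \forall p \near (0 : R, 0 : R),
    `|g x 0 - g (x + p.1 *: e) p.2| < c.
  have : {for (0 : R, 0 : R), continuous (fun p : R * R => g (x + p.1 *: e) p.2)}.
    apply: (@continuous_comp _ _ _ (fun p : R * R => (x + p.1 *: e, p.2))
      (fun p : V * R => g p.1 p.2)); last by rewrite /= line0; exact: rg.1.
    apply: (@continuous_pair _ _ _ (fun p : R * R => x + p.1 *: e) snd).
      by apply: (@continuous_comp _ _ _ fst (fun r : R => x + r *: e));
        [exact: cvg_fst|exact: cl].
    exact: cvg_snd.
  by move/cvgrPdist_lt => /(_ c c0); rewrite /= line0.
have : \forall p \near (0 : R, 0 : R), B (x + p.1 *: e) /\
    `|g x 0 - g (x + p.1 *: e) p.2| < c by exact: filterI n1 n2.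
move=> /nbhs_ballP[/= d d0 hd].
pose r := d / 2.
have r0 : 0 < r by rewrite divr_gt0.
have rd : r < d by rewrite /r ltr_pdivrMr// mulr_natr mulr2n ltrDl.
have inb h s : `|h| < d -> `|s| < d ->
    B (x + h *: e) /\ `|g x 0 - g (x + h *: e) s| < c.
  by move=> hh hs; apply: (hd (h, s)); split; rewrite /ball/= sub0r normrN.
have Br : B (x + r *: e).
  by apply: (inb r 0 _ _).1; rewrite ?normr0// gtr0_norm.
have small y : B y -> \forall s \near 0^'+, `|f y s| < c * r / 2.
  move=> By; have cy : continuous (f y) := regular_continuous_time rf By.
  have := cy (0 : R); move/cvgrPdist_lt => /(_ (c * r / 2)); rewrite f0//.
  have -> : 0 < c * r / 2 by rewrite divr_gt0// mulr_gt0.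
  move=> /(_ isT) h; apply: cvg_within; apply: filterS h => s.
  by rewrite sub0r normrN.
have [s [[s0 sd] [s1 s2]]] : exists s : R,
    (0 < s /\ s < d) /\ (`|f x s| < c * r / 2 /\ `|f (x + r *: e) s| < c * r / 2).
  apply: (@filter_ex _ (0 : R)^'+).
  near=> s; split; split.
  - by near: s; exact: nbhs_right_gt.
  - by near: s; exact: nbhs_right_lt.
  - by near: s; exact: small.
  - by near: s; exact: small.
have sn : `|s| < d by rewrite gtr0_norm.
have hn h : 0 <= h <= r -> `|h| < d.
  by move=> /andP[h0 hr]; rewrite ger0_norm// (le_lt_trans hr).
have D h : 0 <= h <= r -> is_derive h 1 (fun h : R => f (x + h *: e) s)
    (g (x + h *: e) s).
  move=> hI; have [Bh _] := inb h s (hn h hI) sn.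
  have [d1 d2] := fg _ s Bh s0.
  by have := is_derive_line 0 d1; rewrite /dx /partial d2.
have cont : {within `[0, r], continuous (fun h : R => f (x + h *: e) s)}.
  apply: derivable_within_continuous => h; rewrite in_itv/= => hI.
  by have [] := D h hI.
have D' h : h \in `]0, r[%R -> is_derive h 1 (fun h : R => f (x + h *: e) s)
    (g (x + h *: e) s).
  by rewrite in_itv/= => /andP[h0 hr]; apply: D; rewrite !ltW.
have [h] := MVT r0 D' cont.
rewrite in_itv/= line0 subr0 => /andP[h0 hr] E.
have [_ gh] : B (x + h *: e) /\ `|g x 0 - g (x + h *: e) s| < c.
  by apply: inb => //; apply: hn; rewrite !ltW.
have big : c < `|g (x + h *: e) s|.
  have := ler_distD 0 (g x 0) (g (x + h *: e) s).
  have := ler_normD (g x 0 - g (x + h *: e) s) (g (x + h *: e) s).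
  rewrite subrK; have : `|g x 0| = 2 * c by rewrite /c; field.
  lra.
have up : `|f (x + r *: e) s - f x s| < c * r.
  apply: (le_lt_trans (ler_normB _ _)); lra.
have : c * r < `|f (x + r *: e) s - f x s|.
  by rewrite E normrM (gtr0_norm r0) ltr_pM2r.
by move=> /(lt_trans up); rewrite ltxx.
Unshelve. all: by end_near. Qed.

End extension_to_all_times.

(** * The problem with zero data *)

Section continuity_on_the_closure.
Context {R : realType}.
Notation V := 'rV[R]_3.
Implicit Types (f g : V -> R -> R) (A B : set V) (x : V) (t s : R).

Lemma row_within_continuous A (F : V -> V) :
  (forall i, {within A, continuous (fun y => F y 0 i)}) -> {within A, continuous F}.
Proof.
move=> cF; apply/subspace_continuousP => x Ax; apply/cvg_ballP => e e0.
have : \forall y \near within A (nbhs x), forall i : 'I_3, ball (F x 0 i) e (F y 0 i).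
  apply: filter_forall => i.
  have /subspace_continuousP/(_ x Ax)/cvg_ballP := cF i; exact.
by apply: filterS => y h; split => // j i; rewrite ord1; exact: h.
Qed.

Lemma cont_on_slice A (I : set R) f t : cont_on A I f -> I t ->
  {within A, continuous (fun x => f x t)}.
Proof.
move=> cf It; apply/subspace_continuousP => x Ax.
have /subspace_continuousP/(_ (x, t)) cfx := cf.
move=> U /(cfx (conj Ax It)); rewrite /within /= => nU.
have cc : {for x, continuous (fun y : V => (y, t))}.
  by apply: (@continuous_pair _ _ R id (fun=> t)); [exact: cvg_id|exact: cst_continuous].
have n1 : \forall y \near x, (A `*` I) (y, t) -> U (f y t) := cc _ nU.
suff : \forall y \near x, A y -> U (f y t) by [].
by apply: filterS n1 => y h Ay; apply: h; split.
Qed.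

Lemma cont_on_time_independent A (I : set R) (a : V -> R) :
  {within A, continuous a} -> cont_on A I (fun x _ => a x).
Proof.
move=> ca; apply/subspace_continuousP => -[x t] [/= Ax It].
have /subspace_continuousP/(_ x Ax) cax := ca.
move=> U /cax; rewrite /within /= => nU.
have n1 : \forall p \near (x : V, t : R), A p.1 -> U (a p.1).
  exact: (@cvg_fst _ _ (nbhs x) (nbhs t) _ _ nU).
suff : \forall p \near (x : V, t : R), (A `*` I) p -> U (a p.1) by [].
by apply: filterS n1 => -[y s] /= h [Ay _]; exact: h.
Qed.

Lemma within_continuous_entry A (k : V -> 'M[R]_3) i j :
  {within A, continuous k} -> {within A, continuous (fun x => k x i j)}.
Proof.
move=> ck; apply/subspace_continuousP => x Ax.
have /subspace_continuousP/(_ x Ax) ckx := ck.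
exact: (cvg_comp _ _ ckx (@coord_continuous _ _ _ i j (k x))).
Qed.

Lemma dot_ge0 (v : V) : 0 <= dot v v.
Proof. by apply: sumr_ge0 => i _; rewrite -expr2 sqr_ge0. Qed.

Lemma positive_definite_quad_form_ge0 A (k : V -> 'M[R]_3) x v :
  positive_definite_on A k -> A x -> 0 <= quad_form (k x) v.
Proof.
move=> [km [kM h]] /h[_ _ k0 /(_ v)/andP[le _]].
by apply: le_trans le; apply: mulr_ge0; [exact: ltW|exact: dot_ge0].
Qed.

End continuity_on_the_closure.

Section homogeneous_problem.
Context {R : realType}.
Notation V := 'rV[R]_3.
Implicit Types (x : V) (t s : R).
Variables (B S1 S2 : set V) (c : coefficients R).
Hypothesis hB : regular_region B.
Hypothesis hcover : closure S1 `|` S2 = bdry B.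
Variables (T : V -> R -> R) (q : V -> R -> V).
Hypothesis sol : is_solution B S1 S2 c zero_data T q.

Let oB : open B. Proof. by case: hB. Qed.
Let bB : bounded_set B. Proof. by case: hB. Qed.

(** On the closure of [S1] the temperature vanishes, on [S2] the normal flux does.
Where the boundary has no normal, [normal_at] is the zero vector. *)
Lemma boundary_flux_eq0 x t s : 0 <= t -> 0 <= s -> bdry B x ->
  dot (T x t *: q x s) (normal_at B x) = 0.
Proof.
move=> t0 s0; rewrite -hcover => bx.
have dotZ (r : R) (u n : V) : dot (r *: u) n = r * dot u n.
  by rewrite /dot mulr_sumr; apply: eq_bigr => i _; rewrite !mxE mulrA.
rewrite dotZ; case: bx => [Sx|Sx]; first by rewrite (temp_bc sol Sx t0) mul0r.
have [[n nx]|no] := pselect (exists n, outward_unit_normal B x n).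
  have on : outward_unit_normal B x (normal_at B x) by apply: xgetPex; exists n.
  by rewrite (flux_bc sol Sx on s0) mulr0.
rewrite /normal_at xgetPN; last by move=> n nx; apply: no; exists n.
by rewrite /dot big1 ?mulr0// => i _; rewrite mxE mulr0.
Qed.

Let in_pos t : 0 < t -> (`]0, +oo[%classic : set R) t.
Proof. by rewrite /= in_itv/= andbT. Qed.
Let in_nonneg t : 0 < t -> (`[0, +oo[%classic : set R) t.
Proof. by rewrite /= in_itv/= andbT; exact: ltW. Qed.

Lemma partial_flux t s (i j : 'I_3) x : 0 < t -> 0 < s -> B x ->
  is_derive x (delta_mx 0 j) (fun y => (T y t *: q y s) 0 i)
    (dx j T x t * q x s 0 i + T x t * dx j (component q i) x s).
Proof.
move=> t0 s0 Bx.
have E : (fun y => (T y t *: q y s) 0 i) = (T^~ t) * ((component q i)^~ s).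
  by apply/funext => y; rewrite mxE.
have [_ _ _ Tx] := temp_C11 sol; have [Tj _ _ _] := Tx j.
have [_ qj _ _] := flux_C12 sol i.
have dT := Tj x t Bx t0; have dq := (qj j).1 x s Bx s0.
rewrite E; apply: DeriveDef; first exact: (derivableM dT dq).
rewrite (deriveM dT dq) addrC /GRing.scale /=; congr (_ + _); exact: mulrC.
Qed.

(** The divergence of [T(t) q(s)] is [grad T(t) . q(s) + T(t) div q(s)], and both
the gradient of [T] and the divergence of [q] extend continuously to the closure
of [B]; the separate derivatives of [q] need not. *)
Lemma admissible_flux t s : 0 < t -> 0 < s ->
  divergence_admissible B (fun x => T x t *: q x s).
Proof.
move=> t0 s0.
have [Tc _ Tx] := temp_classical sol; have [qc [D Dc eD]] := flux_classical sol.
have cT := cont_on_slice Tc (in_nonneg t0).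
have cq i : {within closure B, continuous (fun x => component q i x s)}.
  by have [h _ _] := qc i; exact: cont_on_slice h (in_nonneg s0).
split.
- apply: row_within_continuous => i.
  rewrite (_ : (fun y => _) = fun y => T y t * component q i y s); last first.
    by apply/funext => y; rewrite mxE.
  by move=> x; exact: (cvgM (cT x) (cq i x)).
- move=> i j; split.
    by move=> x Bx; have [] := partial_flux i j t0 s0 Bx.
  have [cT' _ _ T'x] := temp_C11 sol; have [_ cdT _ _] := T'x j.
  have [cq' dq' _ _] := flux_C12 sol i; have [_ cdq] := dq' j.
  have h1 := cont_on_slice cT' (in_pos t0); have h2 := cont_on_slice cdT (in_pos t0).
  have h3 := cont_on_slice cq' (in_pos s0); have h4 := cont_on_slice cdq (in_pos s0).
  apply: (@subspace_eq_continuous _ _ _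
    (fun x => dx j T x t * component q i x s + T x t * dx j (component q i) x s)).
    move=> x; rewrite inE => Bx.
    by have [_ e] := partial_flux i j t0 s0 Bx; rewrite /from_subspace /partial e.
  by move=> x; exact: (cvgD (cvgM (h2 x) (h3 x)) (cvgM (h1 x) (h4 x))).
- have ex i : exists G, cont_on (closure B) `[0, +oo[ G /\ agree_inside B G (dx i T).
    by have [[G cG eG] _] := Tx i; exists G.
  have [G hG] := choice ex.
  exists (fun x => \sum_(i < 3) G i x t * component q i x s + T x t * D x s).
    have cG i := cont_on_slice (hG i).1 (in_nonneg t0).
    have cD := cont_on_slice Dc (in_nonneg s0).
    have cGq : {within closure B, continuous
        (fun x => \sum_(i < 3) G i x t * component q i x s)}.
      move=> x; apply: cvg_big => [|i _]; first exact: add_continuous.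
      exact: (cvgM (cG i x) (cq i x)).
    by move=> x; exact: (cvgD (cGq x) (cvgM (cT x) (cD x))).
  move=> x Bx; rewrite /divergence eD// mulr_sumr -big_split; apply: eq_bigr => i _ /=.
  by have [_ e] := partial_flux i i t0 s0 Bx; rewrite /partial e (hG i).2.
Qed.

(** The divergence theorem for [T(t) q(s)], in which the energy equation at time
[s] replaces [div q(s)]. *)
Lemma divergence_pairing t s : 0 < t -> 0 < s ->
  space_integral B (fun x r => \sum_(i < 3) dx i T x t * component q i x r -
    heat_capacity c x * T x t * dt T x r) s = 0.
Proof.
move=> t0 s0; have [_ _ _ _ [_ _ [sigma _ divthm]]] := hB.
have := divthm _ (admissible_flux t0 s0).
rewrite [RHS]integral0_eq; last first.
  by move=> x bx; rewrite boundary_flux_eq0// ltW.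
move=> /(congr1 fine) /= h; rewrite -[RHS]h; apply: eq_Rintegral => p; rewrite inE => /= Bp.
rewrite /divergence.
have -> : \sum_(i < 3) partial i (fun y => (T y t *: q y s) 0 i) (vec3 p) =
    \sum_(i < 3) dx i T (vec3 p) t * component q i (vec3 p) s +
    T (vec3 p) t * \sum_(i < 3) dx i (component q i) (vec3 p) s.
  rewrite mulr_sumr -big_split; apply: eq_bigr => i _ /=.
  by have [_ e] := partial_flux i i t0 s0 Bp; rewrite /partial e.
have := energy_eq sol Bp s0; rewrite mulr0 addr0 => /eqP; rewrite eqr_oppLR => /eqP ->.
ring.
Qed.

Let flux_regular i : regular_field B (clamp (component q i)).
Proof.
by apply: clamp_regular => //; have [qc _] := flux_classical sol; have [] := qc i.
Qed.

Let flux_initial i x : B x -> component q i x 0 = 0.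
Proof.
by move=> Bx; rewrite /component (flux_init sol (subset_closure Bx)) mxE.
Qed.

Lemma initial_flux_rate_eq0 i (Q : V -> R -> R) x :
  cont_on (closure B) `[0, +oo[ Q -> agree_inside B Q (dt (component q i)) ->
  B x -> Q x 0 = 0.
Proof.
move=> cQ eQ Bx; rewrite -(clampE Q x (lexx 0)).
apply: (right_derivative_limit (u := clamp (component q i) x)).
- exact: regular_continuous_time (flux_regular i) Bx.
- exact: regular_continuous_time (clamp_regular oB bB cQ) Bx 0.
- move=> s s0; have [_ _ [hq _] _] := flux_C12 sol i.
  exact: (is_derive_extension hq).
- have := @flux_rate_init _ _ _ _ _ _ _ _ sol x i (subset_closure Bx).
  rewrite mxE; apply: cvg_trans; apply: near_eq_cvg; near=> h.
  have h0 : 0 < h by near: h; exact: nbhs_right_gt.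
  by rewrite !clampE// ltW.
Unshelve. all: by end_near. Qed.

Hypotheses (hc : regular_coefficients B c)
  (hk : positive_definite_on (closure B) (conductivity c))
  (ha : forall x, closure B x -> 0 < heat_capacity c x)
  (htT : 0 < tau_T c) (htq : 0 <= tau_q c).

Lemma homogeneous_temperature_eq0 x t : B x -> 0 <= t -> T x t = 0.
Proof.
move=> Bx t0; rewrite -(clampE T x t0).
have [Tc [Td Tdc eTd] Tx] := temp_classical sol.
have [qc _] := flux_classical sol.
have [_ hTt _ Tj] := temp_C11 sol.
have exG i : exists G, cont_on (closure B) `[0, +oo[ G /\ agree_inside B G (dx i T).
  by have [[G cG eG] _] := Tx i; exists G.
have exGd i : exists G, agree_inside B G (dt (dx i T)).
  by have [_ [G cG eG]] := Tx i; exists G.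
have exQ i : exists G, cont_on (closure B) `[0, +oo[ G /\
    agree_inside B G (dt (component q i)).
  by have [_ [G cG eG] _] := qc i; exists G.
have exQd i : exists G, agree_inside B G (dt (dt (component q i))).
  by have [_ _ [G cG eG]] := qc i; exists G.
have [G hG] := choice exG; have [Gd hGd] := choice exGd.
have [Q hQ] := choice exQ; have [Qd hQd] := choice exQd.
have T0 y : B y -> T y 0 = 0.
  by move=> By; rewrite (temp_init sol (subset_closure By)).
have rT : regular_field B (clamp T) by exact: clamp_regular.
have rG i : regular_field B (clamp (G i)) by apply: clamp_regular => //; exact: (hG i).1.
have rQ i : regular_field B (clamp (Q i)) by apply: clamp_regular => //; exact: (hQ i).1.
have G0 i y : B y -> G i y 0 = 0.
  move=> By; rewrite -(clampE (G i) y (lexx 0)).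
  apply: (gradient_initial (i := i) (f := clamp T) oB) By => //.
    by move=> z Bz; rewrite clampE// T0.
  move=> z s Bz s0; rewrite (clampE _ _ (ltW s0)) (hG i).2//.
  rewrite (_ : (clamp T)^~ s = T^~ s); last first.
    by apply/funext => w; rewrite clampE// ltW.
  by apply: DeriveDef => //; have [hx _ _ _] := Tj i; exact: hx.
have Dq i y s : B y -> 0 < s ->
    is_derive s 1 (clamp (component q i) y) (clamp (Q i) y s).
  move=> By s0; have [_ _ [hq _] _] := flux_C12 sol i.
  by apply: (is_derive_extension hq) => //; exact: (hQ i).2.
have Q0 i y : B y -> Q i y 0 = 0.
  by apply: (initial_flux_rate_eq0 (i := i)); [exact: (hQ i).1|exact: (hQ i).2].
have [ca _ ck ksym] := hc.
apply: (@temperature_eq0 _ B oB bB (heat_capacity c) (conductivity c) (tau_q c)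
  (tau_T c) _ _ _ _ _ htT htq (clamp T) (clamp Td) (fun i => clamp (G i))
  (fun i => clamp (Gd i)) (fun i => clamp (component q i)) (fun i => clamp (Q i))
  (fun i => clamp (Qd i))) => //.
- apply: (clamp_regular (f := fun x _ => heat_capacity c x)) => //.
  exact: cont_on_time_independent.
- move=> i j; apply: (clamp_regular (f := fun x _ => conductivity c x i j)) => //.
  by apply: cont_on_time_independent; exact: within_continuous_entry.
- by move=> y By; apply: ha; exact: subset_closure.
- by move=> y By; apply: ksym; exact: subset_closure.
- move=> y By v; apply: positive_definite_quad_form_ge0 hk _.
  exact: subset_closure.
- exact: clamp_regular.
- exact: clamp_causal.
- by move=> i; apply: clamp_causal => y; exact: G0.
- by move=> i; apply: clamp_causal => y; exact: flux_initial.
- by move=> i; apply: clamp_causal => y; exact: Q0.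
- by move=> y s By s0; apply: (is_derive_extension hTt).
- move=> i y s By s0; have [_ _ hx _] := Tj i.
  by apply: (is_derive_extension hx) => //; exact: (hG i).2.
- move=> i y s By s0; have [_ _ _ [hq _]] := flux_C12 sol i.
  by apply: (is_derive_extension hq) => //; exact: (hQ i).2.
- move=> i y s By s0; rewrite !clampE ?ltW// (hQ i).2// (hQd i y s)//.
  rewrite (constitutive_eq sol i By s0); congr (- _ - _).
    by apply: eq_bigr => j _; rewrite clampE ?ltW// (hG j).2.
  congr (_ * _); apply: eq_bigr => j _.
  by rewrite clampE ?ltW// (hGd j y s).
- move=> r s r0 s0; rewrite -[RHS](divergence_pairing r0 s0).
  apply: eq_space_integral => y By; rewrite !clampE ?ltW// eTd//.
  congr (_ - _); apply: eq_bigr => i _.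
  by rewrite !clampE ?ltW// (hG i).2.
Qed.

(** With the temperature equal to zero, the flux at each point solves the ordinary
differential equation [q + tau_q q' + tau_q ^ 2 q'' / 2 = 0] with zero initial
values, and [q ^ 2 + tau_q ^ 2 q' ^ 2 / 2] has derivative [- 2 tau_q q' ^ 2].
This also covers [tau_q = 0]. *)
Lemma homogeneous_flux_eq0 i x t : B x -> 0 <= t -> component q i x t = 0.
Proof.
move=> Bx t0.
have [qc _] := flux_classical sol; have [_ [Q Qc eQ] [Qd _ eQd]] := qc i.
have [_ _ [hq _] [hqd _]] := flux_C12 sol i.
have rq := flux_regular i.
have rQ : regular_field B (clamp Q) by exact: clamp_regular.
have q0 := flux_initial i Bx.
have Dq s : 0 < s -> is_derive s 1 (clamp (component q i) x) (clamp Q x s).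
  by move=> s0; apply: (is_derive_extension hq).
have DQ s : 0 < s -> is_derive s 1 (clamp Q x) (clamp Qd x s).
  by move=> s0; apply: (is_derive_extension hqd).
have Q0 : clamp Q x 0 = 0 by rewrite clampE// (initial_flux_rate_eq0 Qc eQ Bx).
have gradient0 j : agree_inside B (fun _ _ => 0) (dx j T).
  move=> y s By s0; rewrite /dx /partial.
  rewrite (@near_eq_derive _ _ _ _ (fun=> 0)); first by rewrite derive_cst.
  have := open_nbhs_nbhs (conj oB By); apply: filterS => z Bz.
  by rewrite homogeneous_temperature_eq0// ltW.
have gradient_rate0 j s : 0 < s -> dt (dx j T) x s = 0.
  move=> s0; rewrite -(agree_dt (gradient0 j))// /dt derive1E.
  exact: derive_cst.
have ode s : 0 < s -> clamp (component q i) x s + tau_q c * clamp Q x s +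
    2^-1 * tau_q c ^+ 2 * clamp Qd x s = 0.
  move=> s0; rewrite !clampE ?ltW// eQ// eQd// (constitutive_eq sol i Bx s0).
  rewrite big1 => [|j _]; last by rewrite -gradient0// mulr0.
  rewrite big1 => [|j _]; last by rewrite gradient_rate0// mulr0.
  by rewrite mulr0 subr0 oppr0.
pose E s := clamp (component q i) x s * clamp (component q i) x s +
  2^-1 * tau_q c ^+ 2 * (clamp Q x s * clamp Q x s).
have E0 : E t <= 0.
  apply: (@gronwall _ E (fun s => 2 * clamp Q x s * (clamp (component q i) x s +
    2^-1 * tau_q c ^+ 2 * clamp Qd x s)) 0 t) => //.
  - move=> s _; have cq' := regular_continuous_time rq Bx.
    have cQ' := regular_continuous_time rQ Bx.
    exact: (cvgD (cvgM (cq' s) (cq' s)) (cvgM (cvg_cst _) (cvgM (cQ' s) (cQ' s)))).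
  - move=> s s0; apply: (is_derive_eq (is_derive_add (is_derive_mul (Dq s s0) (Dq s s0))
      (is_derive_scale _ (is_derive_mul (DQ s s0) (DQ s s0))))).
    ring.
  - move=> s s0; rewrite mul0r.
    have -> : clamp (component q i) x s + 2^-1 * tau_q c ^+ 2 * clamp Qd x s =
       - (tau_q c * clamp Q x s) by have := ode s s0; lra.
    rewrite mulrN oppr_le0.
    have -> : 2 * clamp Q x s * (tau_q c * clamp Q x s) =
      2 * tau_q c * (clamp Q x s) ^+ 2 by ring.
    by rewrite mulr_ge0 ?sqr_ge0// mulr_ge0.
  - by rewrite /E Q0 clampE// q0 !mulr0 addr0.
have : clamp (component q i) x t ^+ 2 <= 0.
  apply: le_trans E0; rewrite /E expr2 lerDl; apply: mulr_ge0.
    by apply: mulr_ge0; [rewrite invr_ge0|exact: sqr_ge0].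
  by rewrite -expr2 sqr_ge0.
by rewrite clampE// => h; apply/eqP; rewrite -sqrf_eq0 eq_le h sqr_ge0.
Qed.

Lemma homogeneous_solution_eq0 x t : closure B x -> 0 <= t ->
  T x t = 0 /\ q x t = 0.
Proof.
move=> Bx t0; split.
  have [Tc _ _] := temp_classical sol.
  apply: (closure_eq0 Tc _ Bx t0) => y By.
  exact: homogeneous_temperature_eq0.
apply/rowP => i; rewrite mxE.
have [qc _] := flux_classical sol; have [cq _ _] := qc i.
apply: (closure_eq0 cq _ Bx t0) => y By.
exact: homogeneous_flux_eq0.
Qed.

End homogeneous_problem.

Theorem theorem2 (R : realType) (B S1 S2 : set 'rV[R]_3)
  (c : coefficients R) (d : data R)
  (hB : regular_region B)
  (hS1 : S1 `<=` bdry B) (hS2 : S2 `<=` bdry B)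
  (hcover : closure S1 `|` S2 = bdry B) (hdisj : S1 `&` S2 = set0)
  (hc : regular_coefficients B c)
  (hd : smooth_data B S1 S2 d)
  (hk : positive_definite_on (closure B) (conductivity c))
  (ha : forall x, closure B x -> 0 < heat_capacity c x)
  (htT : 0 < tau_T c) (htq : 0 <= tau_q c)
  (T1 T2 : 'rV[R]_3 -> R -> R) (q1 q2 : 'rV[R]_3 -> R -> 'rV[R]_3) :
  is_solution B S1 S2 c d T1 q1 -> is_solution B S1 S2 c d T2 q2 ->
  forall x t, closure B x -> 0 <= t -> T1 x t = T2 x t /\ q1 x t = q2 x t.
Proof.
move=> h1 h2 x t Bx t0.
have [/eqP e1 /eqP e2] := homogeneous_solution_eq0 hB hcover
  (is_solution_sub h1 h2) hc hk ha htT htq Bx t0.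
by split; apply/eqP; rewrite -subr_eq0.
Qed.
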